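(* Let $\kappa$ be a cardinal, $\alpha<\kappa$, and let $\vec U=\langle U_\gamma\mid\gamma<\alpha\rangle$ be a sequence of normal ultrafilters on $\kappa$ that is increasing in the Mitchell order. Let $\vec f=\langle f^\delta_\gamma\mid\gamma<\delta<\alpha\rangle$ be functions with $[f^\delta_\gamma]_{U_\delta}=U_\gamma$, let $\mathbb M=\mathbb M(\vec U,\vec f)$ be the associated Magidor forcing, and let $\mathbb M^*$ be its complete Boolean algebra. Let $\langle M_\gamma\mid\gamma\le\alpha\rangle$, $\langle\pi_{\gamma,\delta}\mid\gamma\le\delta\le\alpha\rangle$ be the iteration in which, at stage $\xi<\alpha$, the ultrapower of $M_\xi$ by $\pi_{0,\xi}(U_\xi)$ is formed, let $\vec\kappa=\langle\kappa_\gamma\mid\gamma<\alpha\rangle$ be its sequence of critical points, and let $G^*_{\vec\kappa}$ be the ultrafilter on $\pi_{0,\alpha}(\mathbb M^* )$ generated by the $M_\alpha$-generic filter $G_{\vec\kappa}\subseteq\pi_{0,\alpha}(\mathbb M)$ determined by $\vec\kappa$. Then $M_\alpha$ is the Boolean ultrapower of $\mathrm V$ by the ultrafilter $F=\pi_{0,\alpha}^{-1}[G^*_{\vec\kappa}]=\{b\in\mathbb M^*\mid\pi_{0,\alpha}(b)\in G^*_{\vec\kappa}\}$ on $\mathbb M^*$.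
   Context: Mitchell order: $\mu$ is below $\nu$ iff $\mu\in\mathrm{Ult}(\mathrm V,\nu)$. Iteration: $M_0=\mathrm V$, $\pi_{0,0}=\mathrm{id}$; for $\xi<\alpha$, $\pi_{\xi,\xi+1}:M_\xi\to M_{\xi+1}$ is the ultrapower embedding (with $M_{\xi+1}$ transitive) of $M_\xi$ by $\pi_{0,\xi}(U_\xi)$, and $\pi_{\zeta,\xi+1}=\pi_{\xi,\xi+1}\circ\pi_{\zeta,\xi}$; at limits the (transitivized) direct limit is taken. Magidor forcing: the functions $f^\delta_\gamma$ have domain $\kappa$. For $\beta<\alpha$ let $A_\beta$ be the set of $\xi$ with $\alpha<\xi<\kappa$ such that for all $\gamma<\beta$, $f^\beta_\gamma(\xi)$ is a normal ultrafilter on $\xi$, and for all $\gamma<\delta<\beta$, $[f^\delta_\gamma\restriction\xi]_{f^\beta_\delta(\xi)}=f^\beta_\gamma(\xi)$ (so $A_\beta\in U_\beta$). Conditions of $\mathbb M$ are pairs $\langle s,T\rangle$ such that: $s$ is a strictly increasing function whose domain is a finite subset of $\alpha$, with $s(\beta)\in A_\beta$ for $\beta\in\mathrm{dom}(s)$; $T$ is a function with domain $\alpha\setminus\mathrm{dom}(s)$; for $\beta\in\mathrm{dom}(T)$, if no element of $\mathrm{dom}(s)$ is greater than $\beta$ then $T(\beta)\in U_\beta$, and otherwise, letting $\gamma=\min(\mathrm{dom}(s)\setminus(\beta+1))$, $T(\beta)\in f^\gamma_\beta(s(\gamma))$; and if $\mathrm{dom}(s)\cap\beta\ne\emptyset$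 then $T(\beta)\cap(s(\max(\mathrm{dom}(s)\cap\beta))+1)=\emptyset$. The order is: $\langle s',T'\rangle\le\langle s,T\rangle$ iff $s\subseteq s'$, $s'(\beta)\in T(\beta)$ for all $\beta\in\mathrm{dom}(s')\setminus\mathrm{dom}(s)$, and $T'(\beta)\subseteq T(\beta)$ for all $\beta\in\alpha\setminus\mathrm{dom}(s')$. $\mathbb M^*$ is the complete Boolean algebra of $\mathbb M$, with $\mathbb M$ viewed as a dense subset. The filter $G_{\vec\kappa}$ is the set of $\langle s,T\rangle\in\pi_{0,\alpha}(\mathbb M)$ with $s=\vec\kappa\restriction\mathrm{dom}(s)$ and $\kappa_\xi\in T(\xi)$ for all $\xi\in\alpha\setminus\mathrm{dom}(s)$. It is a known fact (which may be assumed) that $G_{\vec\kappa}$ is $\pi_{0,\alpha}(\mathbb M)$-generic over $M_\alpha$. Boolean ultrapower: for a complete Boolean algebra $\mathbb B$ and an ultrafilter $U\in\mathrm V$ on $\mathbb B$, identify $\mathbb B$-names $\sigma,\tau$ when $[\![\sigma=\tau]\!]\in U$, and let $[\sigma]_U\,E\,[\tau]_U$ iff $[\![\sigma\in\tau]\!]\in U$. The Boolean ultrapower $\check{\mathrm V}_U$ consists of the classes $[\sigma]_U$ of names with $[\![\sigma\in\check{\mathrm V}]\!]\in U$, where $[\![\sigma\in\check{\mathrm V}]\!]=\bigvee_{x\in\mathrm V}[\![\sigma=\check x]\!]$, equipped with $E$, and is identified with its transitive collapse when well-founded. *)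

(* Defs.v *)
From Stdlib Require Import FunctionalExtensionality.
From Stdlib Require Import Relation_Operators Transitive_Closure Wellfounded.

(* The universe of sets is a model of second-order ZFC given with its basic
   operations: separation and replacement hold for arbitrary Rocq predicates and
   functions, and membership is well-founded in the sense of Rocq.
   Classes of the universe are predicates [V -> Prop], class functions are
   functions [V -> V]. *)
Record zfc : Type := Zfc {
  univ :> Type;
  mem : univ -> univ -> Prop;
  upair : univ -> univ -> univ;
  union : univ -> univ;
  power : univ -> univ;
  omega : univ;
  sep : univ -> (univ -> Prop) -> univ;
  repl : forall A : univ, ({x : univ | mem x A} -> univ) -> univ;
  extensionality : forall A B, (forall x, mem x A <-> mem x B) -> A = B;
  mem_wf : well_founded mem;
  in_upair : forall x a b, mem x (upair a b) <-> x = a \/ x = b;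
  in_union : forall x A, mem x (union A) <-> exists y, mem x y /\ mem y A;
  in_power : forall x A,
    mem x (power A) <-> forall y, mem y x -> mem y A;
  in_sep : forall x A P, mem x (sep A P) <-> mem x A /\ P x;
  in_repl : forall y A F, mem y (repl A F) <-> exists x, y = F x;
  in_omega : forall x, mem x omega <->
    (forall y, ~ mem y x) \/
    exists n, mem n omega /\ x = union (upair n (upair n n));
  choice_axiom : forall A,
    (forall x, mem x A -> exists y, mem y x) ->
    (forall x y z, mem x A -> mem y A -> mem z x -> mem z y -> x = y) ->
    exists S, forall x, mem x A ->
      exists y, (mem y x /\ mem y S) /\
        forall z, mem z x -> mem z S -> z = y
}.

Arguments mem {z} _ _.
Arguments upair {z} _ _.
Arguments union {z} _.
Arguments power {z} _.
Arguments omega {z}.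
Arguments sep {z} _ _.
Arguments repl {z} _ _.
Arguments extensionality {z} _ _ _.
Arguments mem_wf {z} _.

Declare Scope set_scope.
Delimit Scope set_scope with set.
Open Scope set_scope.

Notation "x ∈ A" := (mem x A) (at level 70, no associativity) : set_scope.
Notation "x ∉ A" := (~ mem x A) (at level 70, no associativity) : set_scope.
Notation "A ⊆ B" := (forall x, mem x A -> mem x B)
  (at level 70, no associativity) : set_scope.

(** * Sets, functions, ordinals *)

Definition empty {V : zfc} : V := sep omega (fun _ => False).
Definition succ {V : zfc} (x : V) : V := union (upair x (upair x x)).
Definition cup {V : zfc} (A B : V) : V := union (upair A B).
Definition diff {V : zfc} (A B : V) : V := sep A (fun x => x ∉ B).
Definition pair {V : zfc} (x y : V) : V := upair (upair x x) (upair x y).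
Definition prod {V : zfc} (A B : V) : V :=
  union (repl A (fun x => repl B (fun y => pair (proj1_sig x) (proj1_sig y)))).

(* If [A] has exactly one element satisfying [P], this is that element. *)
Definition the {V : zfc} (A : V) (P : V -> Prop) : V := union (sep A P).

Definition dom {V : zfc} (f : V) : V :=
  sep (union (union f)) (fun x => exists y, pair x y ∈ f).
Definition app {V : zfc} (f x : V) : V :=
  the (union (union f)) (fun y => pair x y ∈ f).
Definition is_fun {V : zfc} (f A : V) : Prop :=
  (forall z, z ∈ f -> exists x y, x ∈ A /\ z = pair x y) /\
  (forall x, x ∈ A -> exists y, pair x y ∈ f) /\
  (forall x y y', pair x y ∈ f -> pair x y' ∈ f -> y = y').
Definition restr {V : zfc} (f A : V) : V :=
  sep f (fun z => exists x y, x ∈ A /\ z = pair x y).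
Definition const {V : zfc} (A a : V) : V := prod A (upair a a).

Definition ordinal {V : zfc} (a : V) : Prop :=
  (forall x, x ∈ a -> x ⊆ a) /\
  (forall x, x ∈ a -> forall y, y ∈ x -> y ⊆ x).
Definition limit {V : zfc} (a : V) : Prop :=
  ordinal a /\ a <> empty /\ forall b, b ∈ a -> succ b ∈ a.
Definition surjects {V : zfc} (b A : V) : Prop :=
  exists g, is_fun g b /\ forall y, y ∈ A -> exists x, x ∈ b /\ app g x = y.
Definition cardinal {V : zfc} (k : V) : Prop :=
  ordinal k /\ forall b, b ∈ k -> ~ surjects b k.
Definition finite {V : zfc} (A : V) : Prop :=
  exists n, n ∈ omega /\ surjects n A.

(** * Ultrafilters, ultrapowers, Mitchell order *)

Definition ultrafilter {V : zfc} (k U : V) : Prop :=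
  (forall X, X ∈ U -> X ⊆ k) /\
  k ∈ U /\
  empty ∉ U /\
  (forall X Y, X ∈ U -> X ⊆ Y -> Y ⊆ k -> Y ∈ U) /\
  (forall X Y, X ∈ U -> Y ∈ U -> sep X (fun x => x ∈ Y) ∈ U) /\
  (forall X, X ⊆ k -> X ∈ U \/ diff k X ∈ U).

(* Nonprincipal, [k]-complete, and closed under diagonal intersections. *)
Definition normal_ultrafilter {V : zfc} (k U : V) : Prop :=
  ultrafilter k U /\
  (forall x, x ∈ k -> upair x x ∉ U) /\
  (forall b g, b ∈ k -> is_fun g b -> (forall i, i ∈ b -> app g i ∈ U) ->
    sep k (fun x => forall i, i ∈ b -> x ∈ app g i) ∈ U) /\
  (forall g, is_fun g k -> (forall i, i ∈ k -> app g i ∈ U) ->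
    sep k (fun x => forall i, i ∈ x -> x ∈ app g i) ∈ U).

(* The transitive class [N] is the collapse, via [c], of the quotient of the
   structure with domain [X] and membership relation [E] by the equivalence
   [eqv]; [c i] is the collapsed class of [i]. *)
Definition collapse {V : zfc} {I : Type} (X : I -> Prop)
    (eqv E : I -> I -> Prop) (c : I -> V) (N : V -> Prop) : Prop :=
  (forall x y : V, N x -> y ∈ x -> N y) /\
  (forall x : V, N x <-> exists i, X i /\ c i = x) /\
  (forall i j, X i -> X j -> (c i = c j <-> eqv i j)) /\
  (forall i j, X i -> X j -> (c i ∈ c j <-> E i j)).

(* [N] is the transitive ultrapower of the inner model [M] by [U], an
   ultrafilter on [k] in [M], formed with the functions lying in [M]; [c]
   sends a function to its class. *)
Definition ultrapower {V : zfc} (M : V -> Prop) (k U : V)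
    (c : V -> V) (N : V -> Prop) : Prop :=
  collapse (fun g => M g /\ is_fun g k)
    (fun g h => sep k (fun x => app g x = app h x) ∈ U)
    (fun g h => sep k (fun x => app g x ∈ app h x) ∈ U) c N.

(* [mu] belongs to Ult(V, nu), where [nu] is an ultrafilter on [k]. *)
Definition mitchell {V : zfc} (k mu nu : V) : Prop :=
  exists c N, ultrapower (fun _ => True) k nu c N /\ N mu.

(* The class of [g] in Ult(V, nu), where [nu] is an ultrafilter on [k], is [x]. *)
Definition ult_class {V : zfc} (k nu g x : V) : Prop :=
  exists c N, ultrapower (fun _ => True) k nu c N /\ c g = x.

(** * Iterated ultrapowers *)

(* Only the values [M xi] and [pi zeta xi x] with [zeta <= xi <= alpha] and
   [M zeta x] are relevant. *)
Definition iteration {V : zfc} (kappa alpha : V) (U : V -> V)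
    (M : V -> V -> Prop) (pi : V -> V -> V -> V) : Prop :=
  (forall x, M empty x) /\
  (forall xi x, xi ∈ succ alpha -> M xi x -> pi xi xi x = x) /\
  (forall xi, xi ∈ alpha ->
    let k := pi empty xi kappa in
    (exists c, ultrapower (M xi) k (pi empty xi (U xi)) c (M (succ xi)) /\
       forall x, M xi x -> pi xi (succ xi) x = c (const k x)) /\
    (forall zeta x, zeta ∈ succ xi -> M zeta x ->
       pi zeta (succ xi) x = pi xi (succ xi) (pi zeta xi x))) /\
  (* the direct limit consists of threads represented by pairs (zeta, x) *)
  (forall lam, lam ∈ succ alpha -> limit lam ->
    collapse (fun i : V * V => fst i ∈ lam /\ M (fst i) (snd i))
      (fun i j => exists eta, eta ∈ lam /\ fst i ∈ succ eta /\
         fst j ∈ succ eta /\ pi (fst i) eta (snd i) = pi (fst j) eta (snd j))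
      (fun i j => exists eta, eta ∈ lam /\ fst i ∈ succ eta /\
         fst j ∈ succ eta /\ pi (fst i) eta (snd i) ∈ pi (fst j) eta (snd j))
      (fun i => pi (fst i) lam (snd i)) (M lam)).

Definition critical_point {V : zfc} (M : V -> Prop) (j : V -> V) (k : V) : Prop :=
  ordinal k /\ M k /\ j k <> k /\ forall b, b ∈ k -> j b = b.

(** * Magidor forcing; [f delta gamma] is the function f^delta_gamma *)

Definition magidor_A {V : zfc} (kappa alpha : V) (f : V -> V -> V) (b : V) : V :=
  sep kappa (fun xi => alpha ∈ xi /\
    (forall g, g ∈ b -> normal_ultrafilter xi (app (f b g) xi)) /\
    (forall g d, d ∈ b -> g ∈ d ->
      ult_class xi (app (f b d) xi) (restr (f d g) xi) (app (f b g) xi))).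

Definition magidor_cond {V : zfc} (kappa alpha : V) (U : V -> V)
    (f : V -> V -> V) (s T : V) : Prop :=
  is_fun s (dom s) /\ dom s ⊆ alpha /\ finite (dom s) /\
  (forall b g, b ∈ dom s -> g ∈ dom s -> b ∈ g -> app s b ∈ app s g) /\
  (forall b, b ∈ dom s -> app s b ∈ magidor_A kappa alpha f b) /\
  is_fun T (diff alpha (dom s)) /\
  forall b, b ∈ diff alpha (dom s) ->
    ((forall g, g ∈ dom s -> b ∉ g) -> app T b ∈ U b) /\
    (* g = min (dom s \ (b + 1)) *)
    (forall g, g ∈ dom s -> b ∈ g ->
       (forall g', g' ∈ dom s -> b ∈ g' -> g ∈ succ g') ->
       app T b ∈ app (f g b) (app s g)) /\
    (* g = max (dom s ∩ b) *)
    (forall g, g ∈ dom s -> g ∈ b ->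
       (forall g', g' ∈ dom s -> g' ∈ b -> g' ∈ succ g) ->
       forall x, x ∈ app T b -> x ∉ succ (app s g)).

(* The ambient product only serves to make this a set: U_b and the values of
   f^g_b on A_g consist of subsets of kappa. *)
Definition magidor {V : zfc} (kappa alpha : V) (U : V -> V) (f : V -> V -> V) : V :=
  sep (prod (power (prod alpha kappa)) (power (prod alpha (power kappa))))
    (fun p => exists s T, p = pair s T /\ magidor_cond kappa alpha U f s T).

Definition magidor_order {V : zfc} (kappa alpha : V) (U : V -> V)
    (f : V -> V -> V) : V :=
  let P := magidor kappa alpha U f in
  sep (prod P P) (fun z => exists s' T' s T,
    z = pair (pair s' T') (pair s T) /\
    s ⊆ s' /\
    (forall b, b ∈ diff (dom s') (dom s) -> app s' b ∈ app T b) /\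
    (forall b, b ∈ diff alpha (dom s') -> app T' b ⊆ app T b)).

(** * Forcing notions and complete Boolean algebras, as sets [P], [B] with an
    order relation [le], a set of ordered pairs *)

Definition generic {V : zfc} (M : V -> Prop) (P le : V) (G : V -> Prop) : Prop :=
  (forall p, G p -> p ∈ P) /\
  (exists p, G p) /\
  (forall p q, G p -> q ∈ P -> pair p q ∈ le -> G q) /\
  (forall p q, G p -> G q -> exists r, G r /\ pair r p ∈ le /\ pair r q ∈ le) /\
  (forall D, M D -> D ⊆ P ->
    (forall p, p ∈ P -> exists d, d ∈ D /\ pair d p ∈ le) ->
    exists d, d ∈ D /\ G d).

Definition is_sup {V : zfc} (B le : V) (X : V -> Prop) (b : V) : Prop :=
  b ∈ B /\ (forall x, X x -> pair x b ∈ le) /\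
  forall b', b' ∈ B -> (forall x, X x -> pair x b' ∈ le) -> pair b b' ∈ le.
Definition is_inf {V : zfc} (B le : V) (X : V -> Prop) (b : V) : Prop :=
  b ∈ B /\ (forall x, X x -> pair b x ∈ le) /\
  forall b', b' ∈ B -> (forall x, X x -> pair b' x ∈ le) -> pair b' b ∈ le.

Definition bsup {V : zfc} (B le : V) (X : V -> Prop) : V := the B (is_sup B le X).
Definition binf {V : zfc} (B le : V) (X : V -> Prop) : V := the B (is_inf B le X).
Definition bzero {V : zfc} (B le : V) : V := bsup B le (fun _ => False).
Definition bone {V : zfc} (B le : V) : V := binf B le (fun _ => False).
Definition bmeet {V : zfc} (B le a b : V) : V := binf B le (fun x => x = a \/ x = b).
Definition bjoin {V : zfc} (B le a b : V) : V := bsup B le (fun x => x = a \/ x = b).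
Definition bcompl {V : zfc} (B le a : V) : V :=
  the B (fun b => bmeet B le a b = bzero B le /\ bjoin B le a b = bone B le).
Definition bimp {V : zfc} (B le a b : V) : V := bjoin B le (bcompl B le a) b.

Definition complete_boolean_algebra {V : zfc} (B le : V) : Prop :=
  (forall a, a ∈ B -> pair a a ∈ le) /\
  (forall a b, a ∈ B -> b ∈ B -> pair a b ∈ le -> pair b a ∈ le -> a = b) /\
  (forall a b c, a ∈ B -> b ∈ B -> c ∈ B ->
    pair a b ∈ le -> pair b c ∈ le -> pair a c ∈ le) /\
  (forall X : V -> Prop, (forall x, X x -> x ∈ B) ->
    (exists b, is_sup B le X b) /\ (exists b, is_inf B le X b)) /\
  (forall a b c, a ∈ B -> b ∈ B -> c ∈ B ->
    bmeet B le a (bjoin B le b c) = bjoin B le (bmeet B le a b) (bmeet B le a c)) /\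
  (forall a, a ∈ B -> exists b, b ∈ B /\
    bmeet B le a b = bzero B le /\ bjoin B le a b = bone B le) /\
  bzero B le <> bone B le.

(* [B] is the complete Boolean algebra of the forcing notion [P], with [e] the
   canonical dense map; [e] need not be injective, as [P] need not be separative. *)
Definition completion {V : zfc} (P leP B leB e : V) : Prop :=
  complete_boolean_algebra B leB /\
  is_fun e P /\
  (forall p, p ∈ P -> app e p ∈ B /\ app e p <> bzero B leB) /\
  (forall p q, p ∈ P -> q ∈ P -> pair p q ∈ leP ->
    pair (app e p) (app e q) ∈ leB) /\
  (forall p q, p ∈ P -> q ∈ P ->
    ~ (exists r, r ∈ P /\ pair r p ∈ leP /\ pair r q ∈ leP) ->
    bmeet B leB (app e p) (app e q) = bzero B leB) /\
  (forall b, b ∈ B -> b <> bzero B leB ->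
    exists p, p ∈ P /\ pair (app e p) b ∈ leB).

Definition boolean_ultrafilter {V : zfc} (B le F : V) : Prop :=
  F ⊆ B /\
  bone B le ∈ F /\
  bzero B le ∉ F /\
  (forall a b, a ∈ F -> b ∈ B -> pair a b ∈ le -> b ∈ F) /\
  (forall a b, a ∈ F -> b ∈ F -> bmeet B le a b ∈ F) /\
  (forall a, a ∈ B -> a ∈ F \/ bcompl B le a ∈ F).

(** * Boolean-valued sets *)

Inductive is_name {V : zfc} (B : V) (s : V) : Prop :=
| Is_name : (forall x, x ∈ s -> exists r b, x = pair r b /\ b ∈ B /\ is_name B r) ->
    is_name B s.

Definition in_name_dom {V : zfc} (r s : V) : Prop := exists b, pair r b ∈ s.

Lemma in_name_dom_wf {V : zfc} : well_founded (@in_name_dom V).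
Proof.
apply (wf_incl _ _ (clos_trans _ (@mem V))).
- intros r s [b Hb].
  apply t_trans with (pair r b); [|now apply t_step].
  apply t_trans with (upair r r); apply t_step; apply in_upair; now left.
- apply wf_clos_trans; exact mem_wf.
Qed.

(* [[s = t]] is the meet of the ([[r in t]]) relativized to s, and of the
   ([[r in s]]) relativized to t; the clauses for [[_ in _]] are inlined, and
   the recursion is on [s] alone, using [[r = r']] for [[r' = r]] in the second
   half. See [bv_eq_unfold]. *)
Definition bv_eq {V : zfc} (B le : V) : V -> V -> V :=
  Fix in_name_dom_wf (fun _ => V -> V) (fun s rec t =>
    bmeet B le
      (binf B le (fun x => exists r b (h : pair r b ∈ s),
        x = bimp B le b (bsup B le (fun y => exists r' b', pair r' b' ∈ t /\
              y = bmeet B le b' (rec r (ex_intro _ b h) r')))))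
      (binf B le (fun x => exists r' b', pair r' b' ∈ t /\
        x = bimp B le b' (bsup B le (fun y => exists r b (h : pair r b ∈ s),
              y = bmeet B le b (rec r (ex_intro _ b h) r')))))).

Definition bv_mem {V : zfc} (B le r t : V) : V :=
  bsup B le (fun y => exists r' b', pair r' b' ∈ t /\
    y = bmeet B le b' (bv_eq B le r r')).

Lemma bv_eq_unfold {V : zfc} (B le s t : V) :
  bv_eq B le s t =
    bmeet B le
      (binf B le (fun x => exists r b (_ : pair r b ∈ s),
        x = bimp B le b (bv_mem B le r t)))
      (binf B le (fun x => exists r' b', pair r' b' ∈ t /\
        x = bimp B le b' (bsup B le (fun y => exists r b (_ : pair r b ∈ s),
              y = bmeet B le b (bv_eq B le r r'))))).
Proof.
unfold bv_eq at 1; rewrite Fix_eq; [reflexivity|].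
intros x g h Hgh.
replace h with g; [reflexivity|].
apply functional_extensionality_dep; intro y.
apply functional_extensionality_dep; intro p; apply Hgh.
Qed.

(* The canonical name of [x]: the set of pairs (check y, 1) for y in x. *)
Definition check {V : zfc} (B le : V) : V -> V :=
  Fix mem_wf (fun _ => V) (fun x rec =>
    repl x (fun y => pair (rec (proj1_sig y) (proj2_sig y)) (bone B le))).

(* The Boolean value that [s] belongs to the ground model. *)
Definition bv_ground {V : zfc} (B le s : V) : V :=
  bsup B le (fun y => exists x, y = bv_eq B le s (check B le x)).

(* [N] is the transitive collapse of the Boolean ultrapower of the universe by
   the ultrafilter [F] on [B]; [c] sends a name to its collapsed class. *)
Definition boolean_ultrapower {V : zfc} (B le F : V)
    (c : V -> V) (N : V -> Prop) : Prop :=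
  collapse (fun s => is_name B s /\ bv_ground B le s ∈ F)
    (fun s t => bv_eq B le s t ∈ F)
    (fun s t => bv_mem B le s t ∈ F) c N.

(** * The filters determined by the critical sequence *)

(* Here [P] is the image of the Magidor forcing under the iteration map. *)
Definition G_crit {V : zfc} (alpha P : V) (kap : V -> V) (p : V) : Prop :=
  p ∈ P /\ exists s T, p = pair s T /\
    (forall xi, xi ∈ dom s -> app s xi = kap xi) /\
    (forall xi, xi ∈ diff alpha (dom s) -> kap xi ∈ app T xi).

(* The filter on [B] generated by the image of [G] under the dense map [e]. *)
Definition generated {V : zfc} (B le e : V) (G : V -> Prop) (b : V) : Prop :=
  b ∈ B /\ exists p, G p /\ pair (app e p) b ∈ le.

(* Main.v *)
(**
Write j for the embedding of V into M_alpha and G for the generic filter.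

Every element of M_alpha is j(h)(p) for some p in G, where h, in V, is a function on a
downward closed set of Magidor conditions that is constant along the order. This follows
by induction along the iteration. By normality every element of the ultrapower M_(xi+1) has
the form pi(g)(kappa_xi), where kappa_xi is fixed by the rest of the iteration, and
kappa_xi is the value at xi of the stem of some condition in G. For the latter no coherence
of the measures is needed: otherwise kappa_xi belongs to the measure one set at xi of every
condition in G, while the conditions that have xi in the domain of the stem or omit
kappa_xi from their measure one set at xi are dense, the ultrafilters being nonprincipal.

A name s for an element of V gives such a function, sending p to the x with p forcing
s = x, and by mixing every such function arises in this way. The collapse of the Boolean
ultrapower sends s to j(h)(p). It is an isomorphism because G, being generic, decides
whether two such functions agree, or whether the value of one belongs to that of the other.

Elementarity is a statement about formulas in the language of membership. To avoid writing
these down, [Def] and [DefT] single out the relations and operations given by one formula in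
all transitive classes that satisfy the formulas valid in V.
*)
Require Import Defs.
From Stdlib Require Import ClassicalEpsilon FunctionalExtensionality.
From Stdlib Require Import PropExtensionality PeanoNat Lia.

(** * Elementary set theory: pairs, functions as sets, ordinals *)

Section Sets.
Context {V : zfc}.
Implicit Types a b c w x y z A B f g : V.

Lemma ext A B : (forall x, x ∈ A <-> x ∈ B) -> A = B.
Proof. apply extensionality. Qed.

Lemma not_in_empty x : x ∉ empty.
Proof. intro H; now apply in_sep in H. Qed.

Lemma mem_irrefl x : x ∉ x.
Proof. induction (mem_wf x) as [x _ IH]; intro H; exact (IH x H H). Qed.

Lemma mem_asym x y : x ∈ y -> y ∉ x.
Proof.
revert y; induction (mem_wf x) as [x _ IH]; intros y H1 H2; exact (IH y H2 x H2 H1).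
Qed.

Lemma in_sing x a : x ∈ upair a a <-> x = a.
Proof. rewrite in_upair; tauto. Qed.

Lemma in_succ x a : x ∈ succ a <-> x ∈ a \/ x = a.
Proof.
unfold succ; rewrite in_union; split.
- intros [y [Hx Hy]]; apply in_upair in Hy as [->| ->]; [now left|].
  right; now apply in_sing.
- intros [H| ->]; [exists a|exists (upair a a)]; rewrite !in_upair; auto.
Qed.

Lemma in_cup x A B : x ∈ cup A B <-> x ∈ A \/ x ∈ B.
Proof.
unfold cup; rewrite in_union; split.
- intros [y [Hx Hy]]; apply in_upair in Hy as [->| ->]; auto.
- intros [H|H]; [exists A|exists B]; rewrite in_upair; auto.
Qed.

Lemma in_diff x A B : x ∈ diff A B <-> x ∈ A /\ x ∉ B.
Proof. apply in_sep. Qed.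

Lemma upair_inj (a b c d : V) : upair a b = upair c d -> (a = c /\ b = d) \/ (a = d /\ b = c).
Proof.
intro H.
assert (Ha : a ∈ upair c d) by (rewrite <- H; apply in_upair; auto).
assert (Hb : b ∈ upair c d) by (rewrite <- H; apply in_upair; auto).
assert (Hc : c ∈ upair a b) by (rewrite H; apply in_upair; auto).
assert (Hd : d ∈ upair a b) by (rewrite H; apply in_upair; auto).
rewrite in_upair in *; intuition congruence.
Qed.

Lemma pair_inj (x y x' y' : V) : pair x y = pair x' y' -> x = x' /\ y = y'.
Proof.
intro H; apply upair_inj in H as [[H1 H2]|[H1 H2]];
  apply upair_inj in H1; apply upair_inj in H2; intuition congruence.
Qed.

Lemma in_prod z A B : z ∈ prod A B <-> exists x y, x ∈ A /\ y ∈ B /\ z = pair x y.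
Proof.
unfold prod; rewrite in_union; split.
- intros [w [Hz Hw]]; apply in_repl in Hw as [[x Hx] ->].
  apply in_repl in Hz as [[y Hy] ->]; simpl; now exists x, y.
- intros [x [y [Hx [Hy ->]]]].
  exists (repl B (fun u => pair x (proj1_sig u))); split; apply in_repl.
  + now exists (exist _ y Hy).
  + now exists (exist _ x Hx).
Qed.

Lemma pair_in_prod x y A B : pair x y ∈ prod A B <-> x ∈ A /\ y ∈ B.
Proof.
rewrite in_prod; split; [|intros [Hx Hy]; eauto].
intros [x' [y' [Hx [Hy E]]]]; apply pair_inj in E as [-> ->]; auto.
Qed.

Lemma pair_union x y f : pair x y ∈ f ->
  x ∈ union (union f) /\ y ∈ union (union f).
Proof.
intro H.
assert (H2 : upair x y ∈ union f).
{ apply in_union; exists (pair x y); split; [apply in_upair|]; auto. }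
split; apply in_union; exists (upair x y); rewrite in_upair; auto.
Qed.

Lemma in_dom x f : x ∈ dom f <-> exists y, pair x y ∈ f.
Proof.
unfold dom; rewrite in_sep; split; [tauto|].
intros [y H]; split; [apply (pair_union x y f H)|eauto].
Qed.

Lemma the_eq A (Q : V -> Prop) x :
  x ∈ A -> Q x -> (forall y, y ∈ A -> Q y -> y = x) -> the A Q = x.
Proof.
intros Hx HQ Hu; apply ext; intro z; unfold the; rewrite in_union; split.
- intros [y [Hz Hy]]; apply in_sep in Hy as [Hy HQy]; now rewrite <- (Hu y Hy HQy).
- intro Hz; exists x; split; [auto|]; now apply in_sep.
Qed.

Lemma app_eq f x y :
  pair x y ∈ f -> (forall y', pair x y' ∈ f -> y' = y) -> app f x = y.
Proof. intros H Hu; apply the_eq; [apply (pair_union x y f H)|auto|auto]. Qed.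

Lemma app_pair f A x y : is_fun f A -> pair x y ∈ f -> app f x = y.
Proof. intros [_ [_ Hu]] H; apply app_eq; [auto|]; intros y' H'; exact (Hu _ _ _ H' H). Qed.

Lemma pair_app f A x : is_fun f A -> x ∈ A -> pair x (app f x) ∈ f.
Proof.
intros Hf Hx; destruct (proj1 (proj2 Hf) x Hx) as [y Hy].
now rewrite (app_pair f A x y).
Qed.

Lemma dom_fun f A : is_fun f A -> dom f = A.
Proof.
intro Hf; apply ext; intro x; rewrite in_dom; split.
- intros [y Hy]; destruct (proj1 Hf _ Hy) as [x' [y' [Hx E]]].
  now apply pair_inj in E as [-> _].
- intro Hx; eexists; exact (pair_app f A x Hf Hx).
Qed.

Definition lam A (F : V -> V) : V :=
  repl A (fun u => pair (proj1_sig u) (F (proj1_sig u))).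

Lemma in_lam z A F : z ∈ lam A F <-> exists x, x ∈ A /\ z = pair x (F x).
Proof.
unfold lam; rewrite in_repl; split.
- intros [[x Hx] E]; simpl in E; eauto.
- intros [x [Hx E]]; now exists (exist _ x Hx).
Qed.

Lemma lam_fun A F : is_fun (lam A F) A.
Proof.
split; [|split].
- intros z Hz; apply in_lam in Hz as [x [Hx ->]]; eauto.
- intros x Hx; exists (F x); apply in_lam; eauto.
- intros x y y' H H'; apply in_lam in H as [a [_ E]], H' as [b [_ E']].
  apply pair_inj in E as [-> ->], E' as [-> ->]; auto.
Qed.

Lemma app_lam A F x : x ∈ A -> app (lam A F) x = F x.
Proof.
intro Hx; apply app_pair with A; [apply lam_fun|]; apply in_lam; eauto.
Qed.

(** Brings constant functions, which are coded as products, under the lemmas on [lam]. *)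
Lemma const_lam A a : const A a = lam A (fun _ => a).
Proof.
apply ext; intro z; unfold const; rewrite in_prod, in_lam; split.
- intros [x [y [Hx [Hy ->]]]]; apply in_sing in Hy as ->; eauto.
- intros [x [Hx ->]]; exists x, a; rewrite in_sing; auto.
Qed.

Lemma ord_mem a b : ordinal a -> b ∈ a -> ordinal b.
Proof.
intros [Ht Hh] Hb; split; [exact (Hh b Hb)|].
intros x Hx; apply Hh; exact (Ht b Hb x Hx).
Qed.

Lemma ord_trans a b c : ordinal a -> b ∈ a -> c ∈ b -> c ∈ a.
Proof. intros [Ht _] Hb Hc; exact (Ht b Hb c Hc). Qed.

Lemma ord_succ a : ordinal a -> ordinal (succ a).
Proof.
intros Ha; split.
- intros x Hx y Hy; rewrite in_succ in *; left.
  destruct Hx as [Hx| ->]; [exact (ord_trans a x y Ha Hx Hy)|auto].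
- intros x Hx; apply in_succ in Hx as [Hx| ->]; [|exact (proj1 Ha)].
  exact (proj1 (ord_mem a x Ha Hx)).
Qed.

(** Double induction on membership: if neither ordinal belongs to the other, the induction
    hypotheses put every element of each into the other, and extensionality applies. *)
Lemma ord_total a b : ordinal a -> ordinal b -> a ∈ b \/ a = b \/ b ∈ a.
Proof.
revert b; induction (mem_wf a) as [a _ IHa]; intro b.
induction (mem_wf b) as [b _ IHb]; intros Ha Hb.
destruct (classic (a ∈ b)) as [|Hab]; [auto|].
destruct (classic (b ∈ a)) as [|Hba]; [auto|]; right; left.
apply ext; intro x; split; intro Hx.
- destruct (IHa x Hx b (ord_mem a x Ha Hx) Hb) as [H|[->|H]]; [auto|contradiction|].
  destruct Hba; exact (ord_trans a x b Ha Hx H).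
- destruct (IHb x Hx Ha (ord_mem b x Hb Hx)) as [H|[->|H]]; [|contradiction|auto].
  destruct Hab; exact (ord_trans b x a Hb Hx H).
Qed.

Lemma ord_cases a : ordinal a ->
  a = empty \/ (exists b, a = succ b) \/ limit a.
Proof.
intro Ha; destruct (classic (a = empty)) as [|H0]; [auto|right].
destruct (classic (exists b, a = succ b)) as [|Hs]; [auto|right].
split; [auto|split; [auto|]]; intros b Hb.
destruct (ord_total (succ b) a) as [H|[H|H]]; auto.
- exact (ord_succ b (ord_mem a b Ha Hb)).
- destruct Hs; eauto.
- apply in_succ in H as [H| ->]; [destruct (mem_asym _ _ H Hb)|destruct (mem_irrefl _ Hb)].
Qed.

End Sets.

(** * First-order definability over transitive classes *)

(** De Bruijn syntax: index 0 is the variable bound by the innermost [Fall]. The remaining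
    connectives are recovered classically. *)
Inductive form : Type :=
| Fmem (i j : nat) | Feq (i j : nat) | Fbot | Fimp (p q : form) | Fall (p : form).

Definition scons {A : Type} (x : A) (e : nat -> A) (n : nat) : A :=
  match n with 0 => x | S n => e n end.

Definition shift (r : nat -> nat) : nat -> nat := scons 0 (fun n => S (r n)).

Fixpoint ren (r : nat -> nat) (p : form) : form :=
  match p with
  | Fmem i j => Fmem (r i) (r j)
  | Feq i j => Feq (r i) (r j)
  | Fbot => Fbot
  | Fimp p q => Fimp (ren r p) (ren r q)
  | Fall p => Fall (ren (shift r) p)
  end.

(** A strict upper bound on the free indices, so that the environment matters only below it; [pred]
    accounts for the index that a quantifier binds. *)
Fixpoint bound (p : form) : nat :=
  match p with
  | Fmem i j | Feq i j => S (max i j)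
  | Fbot => 0
  | Fimp p q => max (bound p) (bound q)
  | Fall p => pred (bound p)
  end.

Section Definability.
Context {V : zfc}.
Notation cls := (V -> Prop).
Notation env := (nat -> V).

Fixpoint sat (M : cls) (p : form) (e : env) : Prop :=
  match p with
  | Fmem i j => e i ∈ e j
  | Feq i j => e i = e j
  | Fbot => False
  | Fimp p q => sat M p e -> sat M q e
  | Fall p => forall x, M x -> sat M p (scons x e)
  end.

Lemma sat_bound M p e e' :
  (forall n, n < bound p -> e n = e' n) -> (sat M p e <-> sat M p e').
Proof.
revert e e'; induction p; simpl; intros e e' H.
- rewrite !H by lia; tauto.
- rewrite !H by lia; tauto.
- tauto.
- rewrite (IHp1 e e'), (IHp2 e e'); [tauto| |]; intros; apply H; lia.
- split; intros Hs x Hx; specialize (Hs x Hx); revert Hs;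
  apply IHp; intros [|n] Hn; simpl; trivial; rewrite H by lia; trivial.
Qed.

Lemma sat_ren M p r e : sat M (ren r p) e <-> sat M p (fun n => e (r n)).
Proof.
revert r e; induction p; simpl; intros r e; try tauto.
- now rewrite IHp1, IHp2.
- split; intros H x Hx; specialize (H x Hx); [apply IHp in H|apply IHp];
  revert H; apply sat_bound; intros [|n] _; reflexivity.
Qed.

Definition top : cls := fun _ => True.
Definition trans_class (M : cls) : Prop := forall x y, M x -> y ∈ x -> M y.
Definition envin (M : cls) (e : env) : Prop := forall n, M (e n).

Lemma envin_scons M x e : M x -> envin M e -> envin M (scons x e).
Proof. intros Hx He [|n]; simpl; auto. Qed.

(** Instead of a list of axioms, everything valid in the universe is required of [M]. Closure of [M]
    under definable operations and choice in [M] then follow from the same facts about the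
    universe. *)
Definition good (M : cls) : Prop :=
  trans_class M /\
  forall p, (forall e, sat top p e) -> forall e, envin M e -> sat M p e.

Lemma good_top : good top.
Proof. split; [easy|auto]. Qed.

Definition elem (M N : cls) (j : V -> V) : Prop :=
  (forall x, M x -> N (j x)) /\
  forall p e, envin M e -> (sat M p e <-> sat N p (fun n => j (e n))).

(** Universal closure: with [n] at least [bound p] it turns validity under all assignments into the
    truth of one sentence, to which elementarity applies. *)
Fixpoint alls (n : nat) (p : form) : form :=
  match n with 0 => p | S n => alls n (Fall p) end.

Lemma alls_valid M n p e : (forall e, envin M e -> sat M p e) -> envin M e ->
  sat M (alls n p) e.
Proof.
revert p e; induction n as [|n IH]; simpl; intros p e H He; [auto|].
apply IH; [|auto]; intros e' He' x Hx; apply H; now apply envin_scons.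
Qed.

Lemma alls_inst M n p e : sat M (alls n p) e -> envin M e -> bound p <= n ->
  forall e', envin M e' -> sat M p e'.
Proof.
intros H He Hn.
(* With [m] quantifiers instantiated, the first [m] values come from [e'] and the others still from
   [e]; for [m = n] the latter are beyond [bound p]. *)
enough (G : forall m p, sat M (alls m p) e ->
  forall e', envin M e' -> sat M p (fun k => if k <? m then e' k else e (k - m))).
{ intros e' He'; generalize (G n p H e' He'); apply sat_bound; intros k Hk.
  destruct (Nat.ltb_spec k n); [auto|lia]. }
clear - He; induction m as [|m IH]; simpl; intros p Hp e' He'.
- revert Hp; apply sat_bound; intros k _; simpl; f_equal; lia.
- specialize (IH _ Hp (fun k => e' (S k)) (fun k => He' (S k)) (e' 0) (He' 0)).
  revert IH; apply sat_bound; intros [|k] _; reflexivity.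
Qed.

(** The universal closure of a formula valid in the universe is valid there too, hence true in [M].
    Being a sentence, it passes to [N] whether or not [j] is onto. *)
Lemma elem_good M N j : (exists x, M x) -> good M -> trans_class N -> elem M N j -> good N.
Proof.
intros [x0 Hx0] [HM HM'] HN [Hj Hp]; split; [auto|]; intros p Hv e He.
assert (Hv' : forall e, sat top (alls (bound p) p) e).
{ intro e0; apply alls_valid; [auto|easy]. }
refine (alls_inst N (bound p) p (fun n => j x0) _ _ _ e He); [|intro; auto|auto].
apply (Hp _ (fun n => x0)); [now intro|]; apply HM'; [auto|now intro].
Qed.

(** A single formula must serve all good classes at once; this is what makes [Q] transfer along
    elementary maps. [Q] takes the class as an argument so that unbounded quantifiers can be
    relativized to it. *)
Definition Def (Q : cls -> env -> Prop) : Prop :=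
  exists p, forall M e, good M -> envin M e -> (sat M p e <-> Q M e).

(** The graph is definable, with the value at index 0 and the parameters shifted by one, and good
    classes are closed under the operation. *)
Definition DefT (t : cls -> env -> V) : Prop :=
  (forall M e, good M -> envin M e -> M (t M e)) /\
  Def (fun M e => e 0 = t M (fun n => e (S n))).

Lemma Def_elem M N j Q e : good M -> good N -> elem M N j -> Def Q -> envin M e ->
  (Q M e <-> Q N (fun n => j (e n))).
Proof.
intros HM HN [Hj Hp] [p Hq] He.
rewrite <- (Hq M e), <- (Hq N); auto; intro; apply Hj, He.
Qed.

Lemma DefT_elem M N j t e : good M -> good N -> elem M N j -> DefT t -> envin M e ->
  j (t M e) = t N (fun n => j (e n)).
Proof.
intros HM HN Hj [Ht HD] He.
apply (Def_elem M N j _ (scons (t M e) e) HM HN Hj HD); [|reflexivity].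
apply envin_scons; [apply Ht|]; auto.
Qed.

Lemma Def_iff Q Q' : (forall M e, good M -> envin M e -> (Q M e <-> Q' M e)) ->
  Def Q -> Def Q'.
Proof.
intros H [p Hp]; exists p; intros M e HM He; rewrite <- H; auto.
Qed.

Lemma Def_ren r Q : Def Q -> Def (fun M e => Q M (fun n => e (r n))).
Proof.
intros [p Hp]; exists (ren r p); intros M e HM He; rewrite sat_ren; apply Hp; auto.
intro; apply He.
Qed.

Lemma Def_false : Def (fun _ _ => False).
Proof. exists Fbot; simpl; tauto. Qed.

Lemma Def_imp P Q : Def P -> Def Q -> Def (fun M e => P M e -> Q M e).
Proof.
intros [p Hp] [q Hq]; exists (Fimp p q); intros M e HM He; simpl.
now rewrite Hp, Hq by auto.
Qed.

Lemma Def_not P : Def P -> Def (fun M e => ~ P M e).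
Proof. intro H; exact (Def_imp _ _ H Def_false). Qed.

Lemma Def_or P Q : Def P -> Def Q -> Def (fun M e => P M e \/ Q M e).
Proof.
intros HP HQ; eapply Def_iff; [|exact (Def_imp _ _ (Def_not _ HP) HQ)].
intros M e _ _; simpl; tauto.
Qed.

Lemma Def_and P Q : Def P -> Def Q -> Def (fun M e => P M e /\ Q M e).
Proof.
intros HP HQ; eapply Def_iff;
  [|exact (Def_not _ (Def_imp _ _ HP (Def_not _ HQ)))].
intros M e _ _; simpl; tauto.
Qed.

Lemma Def_equiv P Q : Def P -> Def Q -> Def (fun M e => P M e <-> Q M e).
Proof. intros HP HQ; apply Def_and; apply Def_imp; auto. Qed.

Lemma Def_all (Q : cls -> env -> V -> Prop) :
  Def (fun M e => Q M (fun n => e (S n)) (e 0)) ->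
  Def (fun M e => forall x, M x -> Q M e x).
Proof.
intros [p Hp]; exists (Fall p); intros M e HM He; simpl; split; intros H x Hx.
- apply (Hp M (scons x e)), H; auto using envin_scons.
- apply Hp; auto using envin_scons; simpl; now apply H.
Qed.

Lemma Def_ex (Q : cls -> env -> V -> Prop) :
  Def (fun M e => Q M (fun n => e (S n)) (e 0)) ->
  Def (fun M e => exists x, M x /\ Q M e x).
Proof.
intro HQ; eapply Def_iff; [|exact (Def_not _ (Def_all (fun M e x => ~ Q M e x) (Def_not _ HQ)))].
intros M e _ _; simpl; split.
- intro H; apply NNPP; intro H'; apply H; intros x Hx Hq; apply H'; eauto.
- intros [x [Hx Hq]] H; exact (H x Hx Hq).
Qed.

(** The syntax has no terms, so a term is substituted by quantifying over a new variable equal to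
    it. *)
Lemma Def_term (Q : cls -> env -> V -> Prop) t : DefT t -> Def (fun M e => Q M (fun n => e (S n)) (e 0)) ->
  Def (fun M e => Q M e (t M e)).
Proof.
intros [Ht Ht'] HQ.
eapply Def_iff; [|exact (Def_ex (fun M e x => x = t M e /\ Q M e x) (Def_and _ _ Ht' HQ))].
intros M e HM He; simpl; split.
- now intros [x [_ [-> H]]].
- intro H; exists (t M e); split; [apply Ht|]; auto.
Qed.

Lemma DefT_ren r t : DefT t -> DefT (fun M e => t M (fun n => e (r n))).
Proof.
intros [H H']; split.
- intros M e HM He; apply H; [auto|intro; apply He].
- exact (Def_ren (shift r) _ H').
Qed.

Lemma DefT_var i : DefT (fun _ e => e i).
Proof. split; [auto|]; now exists (Feq 0 (S i)). Qed.

Lemma Def_mem t u : DefT t -> DefT u -> Def (fun M e => t M e ∈ u M e).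
Proof.
intros Ht Hu; apply (Def_term (fun M e x => x ∈ u M e)); [auto|].
apply (Def_term (fun M e x => e 0 ∈ x)); [exact (DefT_ren S u Hu)|].
now exists (Fmem 1 0).
Qed.

Lemma Def_eq t u : DefT t -> DefT u -> Def (fun M e => t M e = u M e).
Proof.
intros Ht Hu; apply (Def_term (fun M e x => x = u M e)); [auto|].
apply (Def_term (fun M e x => e 0 = x)); [exact (DefT_ren S u Hu)|].
now exists (Feq 1 0).
Qed.

(** Bounded quantifiers need no relativization: by transitivity, the elements of a set in [M] are in
    [M]. *)
Lemma Def_ball t (Q : cls -> env -> V -> Prop) : DefT t -> Def (fun M e => Q M (fun n => e (S n)) (e 0)) ->
  Def (fun M e => forall x, x ∈ t M e -> Q M e x).
Proof.
intros Ht HQ; eapply Def_iff; [|exact (Def_all (fun M e x => x ∈ t M e -> Q M e x)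
  (Def_imp _ _ (Def_mem _ _ (DefT_var 0) (DefT_ren S t Ht)) HQ))].
intros M e HM He; simpl; split; [|auto].
intros H x Hx; apply H; [|auto]; apply (proj1 HM) with (t M e); [apply Ht; auto|auto].
Qed.

Lemma Def_bex t (Q : cls -> env -> V -> Prop) : DefT t -> Def (fun M e => Q M (fun n => e (S n)) (e 0)) ->
  Def (fun M e => exists x, x ∈ t M e /\ Q M e x).
Proof.
intros Ht HQ; eapply Def_iff; [|exact (Def_not _ (Def_ball t (fun M e x => ~ Q M e x) Ht (Def_not _ HQ)))].
intros M e _ _; simpl; split.
- intro H; apply NNPP; intro H'; apply H; intros x Hx Hq; apply H'; eauto.
- intros [x [Hx Hq]] H; exact (H x Hx Hq).
Qed.

(* A good class contains a value of a definable operation, since the universe does. *)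
Lemma DefT_intro (Q : cls -> env -> V -> Prop) t :
  (forall M e z, good M -> envin M e -> M z -> (Q M e z <-> z = t M e)) ->
  Def (fun M e => Q M (fun n => e (S n)) (e 0)) -> DefT t.
Proof.
intros HQ HD.
assert (HE := Def_ex _ HD).
split.
- intros M e HM He; destruct HE as [p Hp].
  assert (H : sat M p e).
  { apply (proj2 HM); [|auto]; intro e0; apply Hp; [apply good_top|easy|].
    exists (t top e0); split; [easy|]; apply HQ; [apply good_top|easy|easy|auto]. }
  apply Hp in H as [z [Hz H]]; auto; apply HQ in H as ->; auto.
- eapply Def_iff; [|exact HD].
  intros M e HM He; simpl; apply HQ; auto; intro; apply He.
Qed.

Lemma DefT_ext t u : (forall M e, good M -> envin M e -> t M e = u M e) -> DefT t -> DefT u.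
Proof.
intros H [Ht HD]; split.
- intros M e HM He; rewrite <- H; [apply Ht| |]; auto.
- eapply Def_iff; [|exact HD]; intros M e HM He; simpl.
  rewrite H; [tauto|auto|intro; apply He].
Qed.

Lemma DefT_upair t u : DefT t -> DefT u -> DefT (fun M e => upair (t M e) (u M e)).
Proof.
intros Ht Hu.
apply (DefT_intro (fun M e z => t M e ∈ z /\ u M e ∈ z /\
  forall w, w ∈ z -> w = t M e \/ w = u M e)).
- intros M e z HM He Hz; split.
  + intros [H1 [H2 H3]]; apply ext; intro w; rewrite in_upair; split; [auto|].
    intros [->| ->]; auto.
  + intros ->; rewrite !in_upair; split; [auto|split; [auto|]].
    intro w; apply in_upair.
- apply Def_and; [|apply Def_and; [|apply Def_ball; [|apply Def_or]]].
  + apply Def_mem; [exact (DefT_ren S t Ht)|apply DefT_var].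
  + apply Def_mem; [exact (DefT_ren S u Hu)|apply DefT_var].
  + apply DefT_var.
  + apply Def_eq; [apply DefT_var|exact (DefT_ren (fun n => S (S n)) t Ht)].
  + apply Def_eq; [apply DefT_var|exact (DefT_ren (fun n => S (S n)) u Hu)].
Qed.

Lemma DefT_pair t u : DefT t -> DefT u -> DefT (fun M e => pair (t M e) (u M e)).
Proof. intros; unfold pair; repeat apply DefT_upair; auto. Qed.

Lemma DefT_union t : DefT t -> DefT (fun M e => union (t M e)).
Proof.
intros Ht.
apply (DefT_intro (fun M e z => (forall w, w ∈ z -> exists y, y ∈ t M e /\ w ∈ y) /\
  forall y, y ∈ t M e -> forall w, w ∈ y -> w ∈ z)).
- intros M e z HM He Hz; split.
  + intros [H1 H2]; apply ext; intro w; rewrite in_union; split.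
    * intro Hw; destruct (H1 w Hw) as [y Hy]; exists y; tauto.
    * intros [y [Hw Hy]]; eauto.
  + intros ->; split.
    * intros w Hw; apply in_union in Hw as [y Hy]; exists y; tauto.
    * intros y Hy w Hw; apply in_union; eauto.
- apply Def_and; apply Def_ball; try apply DefT_var; try apply Def_bex; try apply Def_ball;
    try apply Def_mem; try apply DefT_var; try exact (DefT_ren S t Ht).
  exact (DefT_ren (fun n => S (S n)) t Ht).
Qed.

Lemma DefT_sep t (Q : cls -> env -> V -> Prop) :
  DefT t -> Def (fun M e => Q M (fun n => e (S n)) (e 0)) ->
  DefT (fun M e => sep (t M e) (fun x => Q M e x)).
Proof.
intros Ht HQ.
apply (DefT_intro (fun M e z => (forall w, w ∈ z -> w ∈ t M e /\ Q M e w) /\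
  forall w, w ∈ t M e -> Q M e w -> w ∈ z)).
- intros M e z HM He Hz; split.
  + intros [H1 H2]; apply ext; intro w; rewrite in_sep; split; [auto|].
    intros [Hw Hq]; auto.
  + intros ->; split; intros w; rewrite in_sep; auto.
(* Index 0 is now the element [w] and index 1 the candidate [z], which [Q] has to skip. *)
- assert (HQ2 := Def_ren (scons 0 (fun n => S (S n))) _ HQ).
  apply Def_and; apply Def_ball; try apply DefT_var; try exact (DefT_ren S t Ht).
  + apply Def_and; [|exact HQ2].
    apply Def_mem; [apply DefT_var|exact (DefT_ren (fun n => S (S n)) t Ht)].
  + apply Def_imp; [exact HQ2|]; apply Def_mem; apply DefT_var.
Qed.

Lemma DefT_repl t (u : cls -> env -> V -> V) :
  DefT t -> DefT (fun M e => u M (fun n => e (S n)) (e 0)) ->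
  DefT (fun M e => repl (t M e) (fun x => u M e (proj1_sig x))).
Proof.
intros Ht Hu.
apply (DefT_intro (fun M e z => (forall w, w ∈ z -> exists x, x ∈ t M e /\ w = u M e x) /\
  forall x, x ∈ t M e -> u M e x ∈ z)).
- intros M e z HM He Hz; split.
  + intros [H1 H2]; apply ext; intro w; rewrite in_repl; split.
    * intro Hw; destruct (H1 w Hw) as [x [Hx ->]]; now exists (exist _ x Hx).
    * intros [[x Hx] ->]; auto.
  + intros ->; split.
    * intros w Hw; apply in_repl in Hw as [[x Hx] ->]; eauto.
    * intros x Hx; apply in_repl; now exists (exist _ x Hx).
- apply Def_and; apply Def_ball; try apply DefT_var; try exact (DefT_ren S t Ht).
  + apply Def_bex; [exact (DefT_ren (fun n => S (S n)) t Ht)|].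
    apply Def_eq; [apply DefT_var|].
    exact (DefT_ren (scons 0 (fun n => S (S (S n)))) _ Hu).
  + apply Def_mem; [|apply DefT_var].
    exact (DefT_ren (scons 0 (fun n => S (S n))) _ Hu).
Qed.

Lemma DefT_lam t (u : cls -> env -> V -> V) :
  DefT t -> DefT (fun M e => u M (fun n => e (S n)) (e 0)) ->
  DefT (fun M e => lam (t M e) (fun x => u M e x)).
Proof.
intros Ht Hu; apply (DefT_repl t (fun M e x => pair x (u M e x))); [auto|].
apply DefT_pair; [apply DefT_var|auto].
Qed.

Lemma DefT_const t u : DefT t -> DefT u -> DefT (fun M e => const (t M e) (u M e)).
Proof.
intros Ht Hu; apply (DefT_ext (fun M e => lam (t M e) (fun _ => u M e))).
- intros; now rewrite const_lam.
- apply (DefT_lam t (fun M e x => u M e)); [auto|exact (DefT_ren S u Hu)].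
Qed.

Lemma DefT_app t u : DefT t -> DefT u -> DefT (fun M e => app (t M e) (u M e)).
Proof.
intros Ht Hu; unfold app, the.
apply DefT_union, DefT_sep; [now repeat apply DefT_union|].
apply Def_mem; [|exact (DefT_ren S t Ht)].
apply DefT_pair; [exact (DefT_ren S u Hu)|apply DefT_var].
Qed.

Lemma DefT_diff t u : DefT t -> DefT u -> DefT (fun M e => diff (t M e) (u M e)).
Proof.
intros Ht Hu; unfold diff; apply DefT_sep; [auto|].
apply Def_not, Def_mem; [apply DefT_var|exact (DefT_ren S u Hu)].
Qed.

Lemma DefT_empty : DefT (fun _ _ => empty).
Proof.
(* [empty] is separated from [omega]; separating from an arbitrary parameter gives the same set and
   spares a definition of [omega]. *)
apply (DefT_ext (fun _ e => sep (e 0) (fun _ => False))).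
- intros; apply ext; intro x; unfold empty; rewrite !in_sep; tauto.
- apply DefT_sep; [apply DefT_var|apply Def_false].
Qed.

Lemma DefT_dom t : DefT t -> DefT (fun M e => dom (t M e)).
Proof.
intros Ht.
apply (DefT_ext (fun M e => sep (union (union (t M e)))
  (fun x => exists y, y ∈ union (union (t M e)) /\ pair x y ∈ t M e))).
- intros M e _ _; apply ext; intro x; rewrite in_dom, in_sep; split.
  + intros [_ [y [_ H]]]; eauto.
  + intros [y H]; destruct (pair_union _ _ _ H); eauto.
- apply DefT_sep; [now repeat apply DefT_union|].
  apply Def_bex; [repeat apply DefT_union; exact (DefT_ren S t Ht)|].
  apply Def_mem; [apply DefT_pair; apply DefT_var|].
  exact (DefT_ren (fun n => S (S n)) t Ht).
Qed.

(** Components of the pairs in [f] lie in [union (union f)], so all quantifiers can be bounded and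
    the notion is absolute. *)
Lemma is_fun_bounded (f A : V) : is_fun f A <->
  (forall z, z ∈ f -> exists x, x ∈ A /\ exists y, y ∈ union (union f) /\ z = pair x y) /\
  (forall x, x ∈ A -> exists y, y ∈ union (union f) /\ pair x y ∈ f) /\
  (forall x, x ∈ union (union f) -> forall y, y ∈ union (union f) ->
    forall y', y' ∈ union (union f) -> pair x y ∈ f -> pair x y' ∈ f -> y = y').
Proof.
split; intros [H1 [H2 H3]]; (split; [|split]).
- intros z Hz; destruct (H1 z Hz) as [x [y [Hx ->]]].
  exists x; split; [auto|]; exists y; split; [apply (pair_union _ _ _ Hz)|auto].
- intros x Hx; destruct (H2 x Hx) as [y Hy]; exists y; split; [apply (pair_union _ _ _ Hy)|auto].
- intros x _ y _ y' _; apply H3.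
- intros z Hz; destruct (H1 z Hz) as [x [Hx [y [_ ->]]]]; eauto.
- intros x Hx; destruct (H2 x Hx) as [y [_ Hy]]; eauto.
- intros x y y' H H'; destruct (pair_union _ _ _ H), (pair_union _ _ _ H').
  apply (H3 x); auto.
Qed.

End Definability.

(** Definability is proved by following the syntax. The inner [match] handles hypotheses about terms
    that have been weakened under quantifiers. *)
Ltac def_step :=
  first
  [ assumption | apply DefT_var | apply Def_false | apply DefT_empty
  | match goal with
    | H : @DefT ?V ?t |- @DefT ?V (fun M e => ?t M (fun n => e _)) => apply (DefT_ren _ t H)
    | H : @DefT ?V ?t |- @DefT ?V (fun M e => ?t M e) => exact H
    end
  | apply Def_mem | apply Def_eq | apply Def_and | apply Def_or | apply Def_equiv
  | apply Def_not | apply Def_ball | apply Def_bex | apply Def_all | apply Def_ex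
  | apply Def_imp
  | apply DefT_pair | apply DefT_app | apply DefT_upair | apply DefT_const | apply DefT_dom
  | apply DefT_lam | apply DefT_diff | apply DefT_sep | apply DefT_union ].
Ltac def := repeat (cbn beta; def_step).

(** * Satisfaction of a fixed formula, and choice inside good classes *)

Section Formulas.
Context {V : zfc}.
Notation cls := (V -> Prop).
Notation env := (nat -> V).

Lemma Def_is_fun (t u : cls -> env -> V) : DefT t -> DefT u -> Def (fun M e => is_fun (t M e) (u M e)).
Proof.
intros Ht Hu; eapply Def_iff; [intros M e _ _; symmetry; apply is_fun_bounded|].
def.
Qed.

Lemma Def_sat p (t : nat -> cls -> env -> V) :
  (forall n, DefT (t n)) -> Def (fun M e => sat M p (fun n => t n M e)).
Proof.
revert t; induction p; simpl; intros t Ht.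
- now apply Def_mem.
- now apply Def_eq.
- apply Def_false.
- apply Def_imp; auto.
- apply (Def_all (fun M e x => sat M p (scons x (fun n => t n M e)))).
  (* Under the quantifier the new variable becomes term 0, and the old terms are shifted. *)
  eapply Def_iff; [|apply (IHp (fun n => match n with 0 => fun _ e => e 0
     | S n => fun M e => t n M (fun k => e (S k)) end))].
  + intros M e _ _; simpl; apply sat_bound; intros [|n] _; reflexivity.
  + intros [|n]; [apply DefT_var|]; apply (DefT_ren S _ (Ht n)).
Qed.

(* Choice functions exist in the universe for arbitrary relations. *)
Lemma good_choice (M : cls) (Q : cls -> env -> V -> V -> Prop) t e :
  good M -> envin M e -> DefT t ->
  Def (fun M e => Q M (fun n => e (S (S n))) (e 1) (e 0)) ->
  exists h, M h /\ is_fun h (t M e) /\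
    forall x, x ∈ t M e -> (exists y, M y /\ Q M e x y) -> Q M e x (app h x).
Proof.
intros HM He Ht HQ.
assert (HD : Def (fun M e => exists h, M h /\ (is_fun h (t M e) /\
    forall x, x ∈ t M e -> (exists y, M y /\ Q M e x y) -> Q M e x (app h x)))).
{ apply Def_ex, Def_and; [apply Def_is_fun; def|].
  apply Def_ball; [def|]; apply Def_imp.
  - apply Def_ex.
    exact (Def_ren (fun n => match n with 0 => 0 | 1 => 1 | S (S n) => S (S (S n)) end) _ HQ).
  - apply (Def_term (fun M e y => Q M (fun n => e (S (S n))) (e 0) y)); [def|].
    exact (Def_ren (fun n => match n with 0 => 0 | 1 => 1 | S (S n) => S (S (S n)) end) _ HQ). }
destruct HD as [p Hp]; apply Hp; auto; apply (proj2 HM); [|auto].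
intro e0; apply Hp; [apply good_top|easy|].
exists (lam (t top e0) (fun x => epsilon (inhabits x) (fun y => Q top e0 x y))).
split; [easy|split; [apply lam_fun|]].
intros x Hx [y [_ Hy]]; rewrite app_lam by auto; apply epsilon_spec; eauto.
Qed.

End Formulas.

Ltac def ::= repeat (cbn beta; first [apply Def_is_fun | def_step]).

(** * Elementary maps, and normality relativized to a class *)

Section Elementary.
Context {V : zfc}.
Notation cls := (V -> Prop).

Lemma DefT_closed (M : cls) t e : good M -> DefT t -> envin M e -> M (t M e).
Proof. intros HM [Ht _] He; apply Ht; auto. Qed.

Lemma envin_cst (M : cls) x : M x -> envin M (fun _ => x).
Proof. now intros H n. Qed.

Lemma elem_id (M : cls) (j : V -> V) : (forall x, M x -> j x = x) -> elem M M j.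
Proof.
intro Hj; split; [intros x Hx; now rewrite Hj|].
intros p e He; replace (fun n => j (e n)) with e; [tauto|].
apply functional_extensionality; intro n; symmetry; apply Hj, He.
Qed.

Lemma elem_comp (M N P : cls) (j k l : V -> V) :
  elem M N j -> elem N P k -> (forall x, M x -> l x = k (j x)) -> elem M P l.
Proof.
intros [Hj Hj'] [Hk Hk'] Hl; split; [intros x Hx; rewrite Hl; auto|].
intros p e He; rewrite Hj' by auto.
rewrite (Hk' p (fun n => j (e n))) by (intro; apply Hj, He).
replace (fun n => l (e n)) with (fun n => k (j (e n))); [tauto|].
apply functional_extensionality; intro n; symmetry; apply Hl, He.
Qed.

Lemma elem_mem (M N : cls) j x y : elem M N j -> M x -> M y -> (x ∈ y <-> j x ∈ j y).
Proof.
intros [_ H] Hx Hy; apply (H (Fmem 0 1) (scons x (fun _ => y))).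
now apply envin_scons; [|apply envin_cst].
Qed.

Lemma elem_eq (M N : cls) j x y : elem M N j -> M x -> M y -> (x = y <-> j x = j y).
Proof.
intros [_ H] Hx Hy; apply (H (Feq 0 1) (scons x (fun _ => y))).
now apply envin_scons; [|apply envin_cst].
Qed.

Lemma elem_app (M N : cls) j x y : good M -> good N -> elem M N j -> M x -> M y ->
  j (app x y) = app (j x) (j y).
Proof.
intros HM HN Hj Hx Hy.
apply (DefT_elem M N j (fun _ e => app (e 0) (e 1)) (scons x (fun _ => y)) HM HN Hj); [def|].
now apply envin_scons; [|apply envin_cst].
Qed.

(* [normal_ultrafilter] with unbounded quantifiers relativized to [M]. *)
Definition normal_in (M : cls) (k W : V) : Prop :=
  (forall X, X ∈ W -> X ⊆ k) /\
  k ∈ W /\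
  empty ∉ W /\
  (forall X, X ∈ W -> forall Y, M Y -> X ⊆ Y -> Y ⊆ k -> Y ∈ W) /\
  (forall X, X ∈ W -> forall Y, Y ∈ W -> sep X (fun x => x ∈ Y) ∈ W) /\
  (forall X, M X -> X ⊆ k -> X ∈ W \/ diff k X ∈ W) /\
  (forall x, x ∈ k -> upair x x ∉ W) /\
  (forall b, b ∈ k -> forall g, M g -> is_fun g b -> (forall i, i ∈ b -> app g i ∈ W) ->
    sep k (fun x => forall i, i ∈ b -> x ∈ app g i) ∈ W) /\
  (forall g, M g -> is_fun g k -> (forall i, i ∈ k -> app g i ∈ W) ->
    sep k (fun x => forall i, i ∈ x -> x ∈ app g i) ∈ W).

Lemma normal_in_top k W : normal_ultrafilter k W -> normal_in top k W.
Proof.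
intros [[H1 [H2 [H3 [H4 [H5 H6]]]]] [H7 [H8 H9]]]; unfold normal_in, top.
repeat (split; [now eauto|]); eauto.
Qed.

Lemma Def_normal_in : Def (fun M e => normal_in M (e 0) (e 1)).
Proof. unfold normal_in; def. Qed.

Lemma Def_ordinal : Def (fun (_ : cls) e => ordinal (e 0)).
Proof. unfold ordinal; def. Qed.

End Elementary.

(** * The ultrapower of a good class *)

Ltac envs := repeat (apply envin_scons; [auto|]); apply envin_cst; auto.

Section Ultrapower.
Context {V : zfc}.
Notation cls := (V -> Prop).
Context (M N : cls) (k W : V) (c : V -> V).
Context (HM : good M) (Mk : M k) (HW : normal_in M k W) (Hk : ordinal k).
Context (Hc : ultrapower M k W c N).

Notation large P := (sep k P ∈ W).

Let HMt : forall x y, M x -> y ∈ x -> M y := proj1 HM.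

(** [W] is an ultrafilter only from the point of view of [M]; hence the side conditions that the
    sets concerned lie in [M]. *)
Let large_mono (P Q : V -> Prop) :
  M (sep k Q) -> large P -> (forall x, x ∈ k -> P x -> Q x) -> large Q.
Proof.
intros MQ HP H; destruct HW as [_ [_ [_ [H4 _]]]].
apply (H4 _ HP _ MQ); intros x Hx; apply in_sep in Hx as [Hx Hp]; [|auto].
apply in_sep; auto.
Qed.

Let large_and (P Q : V -> Prop) : large P -> large Q -> large (fun x => P x /\ Q x).
Proof.
intros HP HQ; destruct HW as [_ [_ [_ [_ [H5 _]]]]].
replace (sep k (fun x => P x /\ Q x)) with (sep (sep k P) (fun x => x ∈ sep k Q)); [auto|].
apply ext; intro x; rewrite !in_sep; tauto.
Qed.

Let large_neg (P : V -> Prop) : M (sep k P) -> ~ large P -> large (fun x => ~ P x).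
Proof.
intros MP HP; destruct HW as [_ [_ [_ [_ [_ [H6 _]]]]]].
destruct (H6 _ MP) as [H|H]; [intro x; rewrite in_sep; tauto|contradiction|].
replace (sep k (fun x => ~ P x)) with (diff k (sep k P)); [auto|].
apply ext; intro x; rewrite in_diff, !in_sep; tauto.
Qed.

Let large_true (P : V -> Prop) : (forall x, x ∈ k -> P x) -> large P.
Proof.
intro H; replace (sep k P) with k; [apply HW|].
apply ext; intro x; rewrite in_sep; split; [auto|tauto].
Qed.

Let large_ex (P : V -> Prop) : large P -> exists x, x ∈ k /\ P x.
Proof.
intro H; apply NNPP; intro H'; destruct HW as [_ [_ [H3 _]]]; apply H3.
replace empty with (sep k P); [auto|]; apply ext; intro x; rewrite in_sep.
split; intro Hx; [|now apply not_in_empty in Hx].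
destruct H'; exists x; tauto.
Qed.

Let Msat p g : envin M g -> M (sep k (fun x => sat M p (fun n => app (g n) x))).
Proof.
intro Hg.
apply (DefT_closed M (fun M e => sep (e 0) (fun x => sat M p (fun n => app (e (S n)) x)))
  (scons k g)); [auto| |apply envin_scons; auto].
apply DefT_sep; [def|].
apply (Def_sat p (fun n M e => app (e (S (S n))) (e 0))); intro n; def.
Qed.

(** The theorem of Łoś, by induction on the formula. [Msat] supplies the sets in [M] on which [W]
    can decide, and the quantifier step uses choice in [M]. *)
Lemma los p g : (forall n, M (g n) /\ is_fun (g n) k) ->
  (sat N p (fun n => c (g n)) <-> large (fun x => sat M p (fun n => app (g n) x))).
Proof.
destruct Hc as [_ [HN [Heq Hmem]]].
revert g; induction p; simpl; intros g Hg; assert (Hg' : envin M g) by (intro; apply Hg).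
- apply Hmem; auto.
- apply Heq; auto.
- split; [easy|]; intro H; destruct (large_ex _ H) as [x [_ []]].
- rewrite IHp1, IHp2 by auto; split; intro H.
  + destruct (classic (large (fun x => sat M p1 (fun n => app (g n) x)))) as [H1|H1].
    * apply (large_mono _ _ (Msat (Fimp p1 p2) g Hg') (H H1)); simpl; auto.
    * apply (large_mono _ _ (Msat (Fimp p1 p2) g Hg') (large_neg _ (Msat p1 g Hg') H1)).
      simpl; tauto.
  + intro H1; apply (large_mono _ _ (Msat p2 g Hg') (large_and _ _ H H1)); tauto.
- split; intro H.
  + apply NNPP; intro H'.
    apply large_neg in H'; [|exact (Msat (Fall p) g Hg')].
    (* [h] picks a counterexample at every point that has one. These points form a large set, so the
       class of [h] contradicts the universal statement in [N]. *)
    destruct (good_choice M (fun M e x y => ~ sat M p (scons y (fun n => app (e (S n)) x)))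
      (fun M e => e 0) (scons k g)) as [h [Mh [Hh Hs]]];
      [auto|apply envin_scons; auto|def| |].
    { apply Def_not.
      eapply Def_iff; [|apply (Def_sat p (fun n => match n with 0 => fun _ e => e 0
        | S n => fun M e => app (e (S (S (S n)))) (e 1) end))].
      + intros M0 e _ _; simpl; apply sat_bound; intros [|n] _; reflexivity.
      + intros [|n]; def. }
    simpl in Hs, Hh.
    assert (Hg2 : forall n, M (scons h g n) /\ is_fun (scons h g n) k)
      by (intros [|n]; simpl; auto).
    assert (HNh : N (c h)) by (apply HN; eauto).
    assert (H1 := proj1 (IHp (scons h g) Hg2)).
    destruct (large_ex _ (large_and _ _ H' (H1 ltac:(generalize (H _ HNh); apply sat_bound;
      intros [|n] _; reflexivity)))) as [x [Hx [Hx1 Hx2]]].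
    apply (Hs x Hx).
    * apply not_all_ex_not in Hx1 as [y Hy]; apply imply_to_and in Hy; eauto.
    * revert Hx2; apply sat_bound; intros [|n] _; reflexivity.
  + intros y Hy; apply HN in Hy as [h [[Mh Hh] <-]].
    assert (Hg2 : forall n, M (scons h g n) /\ is_fun (scons h g n) k)
      by (intros [|n]; simpl; auto).
    assert (H1 := proj2 (IHp (scons h g) Hg2)).
    cut (sat N p (fun n => c (scons h g n))).
    { apply sat_bound; intros [|n] _; reflexivity. }
    apply H1; apply (large_mono _ _ (Msat p (scons h g) ltac:(apply envin_scons; auto)) H).
    intros x Hx Hs; generalize (Hs (app h x)
      ltac:(apply (DefT_closed M (fun _ e => app (e 0) (e 1)) (scons h (fun _ => x)));
        [auto|def|apply envin_scons; [auto|apply envin_cst; eauto]])).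
    apply sat_bound; intros [|n] _; reflexivity.
Qed.

Let j x := c (const k x).

Let Mconst x : M x -> M (const k x) /\ is_fun (const k x) k.
Proof.
intro Hx; split; [|rewrite const_lam; apply lam_fun].
apply (DefT_closed M (fun _ e => const (e 0) (e 1)) (scons k (fun _ => x))); [auto|def|envs].
Qed.

Let app_const a x : x ∈ k -> app (const k a) x = a.
Proof. intro Hx; rewrite const_lam, app_lam; auto. Qed.

Lemma ult_elem : elem M N j.
Proof.
split.
- intros x Hx; apply Hc; exists (const k x); auto.
- intros p e He; unfold j.
  rewrite (los p (fun n => const k (e n))) by (intro; auto).
  assert (E : forall x, x ∈ k -> (fun n => app (const k (e n)) x) = e).
  { intros x Hx; apply functional_extensionality; intro n; auto. }
  split; intro H.
  + apply large_true; intros x Hx; now rewrite E.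
  + apply large_ex in H as [x [Hx H]]; now rewrite E in H.
Qed.

Lemma ult_good : good N.
Proof.
apply (elem_good M N j); [eauto|auto|exact (proj1 Hc)|apply ult_elem].
Qed.

Let c_const_mem g a : M g -> is_fun g k -> M a -> (c g ∈ j a <-> large (fun x => app g x ∈ a)).
Proof.
intros Mg Hg Ma; unfold j.
rewrite (proj2 (proj2 (proj2 Hc)) g (const k a)) by auto.
replace (sep k (fun x => app g x ∈ app (const k a) x)) with (sep k (fun x => app g x ∈ a));
  [tauto|].
apply ext; intro x; rewrite !in_sep; split; intros [Hx H]; rewrite app_const in *; auto.
Qed.

Let c_const_eq g a : M g -> is_fun g k -> M a -> large (fun x => app g x = a) -> c g = j a.
Proof.
intros Mg Hg Ma H; unfold j.
apply (proj1 (proj2 (proj2 Hc)) g (const k a)); auto.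
replace (sep k (fun x => app g x = app (const k a) x)) with (sep k (fun x => app g x = a));
  [auto|].
apply ext; intro x; rewrite !in_sep; split; intros [Hx H']; rewrite app_const in *; auto.
Qed.

(** The sequence of sets to which completeness and diagonal intersection are applied: a point in all
    of them is one where [g] takes no value in [b]. *)
Let avoid g b := lam b (fun a => sep k (fun x => app g x <> a)).

Let Mavoid g b : M g -> M b -> M (avoid g b).
Proof.
intros; unfold avoid.
apply (DefT_closed M (fun _ e => lam (e 1) (fun a => sep (e 2) (fun x => app (e 0) x <> a)))
  (scons g (scons b (fun _ => k)))); [auto|def|envs].
Qed.

Let Meq g a : M g -> M a -> M (sep k (fun x => app g x = a)).
Proof.
intros; apply (DefT_closed M (fun _ e => sep (e 0) (fun x => app (e 1) x = e 2))
  (scons k (scons g (fun _ => a)))); [auto|def|envs].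
Qed.

(** By completeness, a function with values in [b] on a large set is constant on a large set, since
    otherwise the sets of [avoid] would have a large intersection. So the elements of [j b] are the
    [j a] with [a] in [b], which are fixed by induction. *)
Lemma ult_fix b : b ∈ k -> j b = b.
Proof.
induction (mem_wf b) as [b _ IH]; intro Hb.
assert (Hbk : forall a, a ∈ b -> a ∈ k) by (intros a; exact (ord_trans k b a Hk Hb)).
assert (Mb : M b) by eauto.
apply ext; intro z; split; intro Hz.
- assert (Nz : N z).
  { apply (proj1 Hc (j b) z); [apply ult_elem; auto|auto]. }
  apply (proj1 (proj2 Hc)) in Nz as [g [[Mg Hg] <-]].
  apply c_const_mem in Hz; auto.
  destruct (classic (exists a, a ∈ b /\ large (fun x => app g x = a))) as [[a [Ha H]]|H].
  + now rewrite (c_const_eq g a Mg Hg (HMt _ _ Mb Ha) H), (IH a Ha (Hbk a Ha)).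
  + exfalso; destruct HW as [_ [_ [_ [_ [_ [_ [_ [H8 _]]]]]]]].
    assert (H' : forall a, a ∈ b -> app (avoid g b) a ∈ W).
    { intros a Ha; unfold avoid; rewrite app_lam by auto; apply large_neg; [apply Meq; eauto|].
      intro; apply H; eauto. }
    specialize (H8 b Hb _ (Mavoid g b Mg Mb) (lam_fun _ _) H').
    destruct (large_ex _ (large_and _ _ Hz H8)) as [x [Hx [Hx1 Hx2]]].
    specialize (Hx2 _ Hx1); unfold avoid in Hx2; rewrite app_lam in Hx2 by auto.
    apply in_sep in Hx2; tauto.
- rewrite <- (IH z Hz (Hbk z Hz)).
  apply (elem_mem M N j z b ult_elem (HMt _ _ Mb Hz) Mb); auto.
Qed.

Let Mid : M (lam k (fun x => x)).
Proof. apply (DefT_closed M (fun _ e => lam (e 0) (fun x => x)) (fun _ => k)); [auto|def|envs]. Qed.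

(** This is where normality enters: by diagonal intersection, a function regressive on a large set
    is constant on a large set, so each element of the class of the identity is some [j a = a] with
    [a] in [k]. *)
Lemma ult_seed : c (lam k (fun x => x)) = k.
Proof.
set (d := lam k (fun x => x)) in *.
assert (Hd : is_fun d k) by apply lam_fun.
assert (Had : forall x, x ∈ k -> app d x = x) by (intros; apply app_lam; auto).
assert (Hmem : forall g, M g -> is_fun g k -> (c g ∈ c d <-> large (fun x => app g x ∈ x))).
{ intros g Mg Hg; rewrite (proj2 (proj2 (proj2 Hc)) g d) by auto.
  replace (sep k (fun x => app g x ∈ app d x)) with (sep k (fun x => app g x ∈ x)); [tauto|].
  apply ext; intro x; rewrite !in_sep; split; intros [Hx H]; rewrite Had in *; auto. }
apply ext; intro z; split; intro Hz.
- assert (Nz : N z).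
  { apply (proj1 Hc (c d) z); [apply Hc; eauto|auto]. }
  apply (proj1 (proj2 Hc)) in Nz as [g [[Mg Hg] <-]].
  apply Hmem in Hz; auto.
  destruct (classic (exists a, a ∈ k /\ large (fun x => app g x = a))) as [[a [Ha H]]|H].
  + now rewrite (c_const_eq g a Mg Hg (HMt _ _ Mk Ha) H), ult_fix.
  + exfalso; destruct HW as [_ [_ [_ [_ [_ [_ [_ [_ H9]]]]]]]].
    assert (H' : forall a, a ∈ k -> app (avoid g k) a ∈ W).
    { intros a Ha; unfold avoid; rewrite app_lam by auto; apply large_neg; [apply Meq; eauto|].
      intro; apply H; eauto. }
    specialize (H9 _ (Mavoid g k Mg Mk) (lam_fun _ _) H').
    destruct (large_ex _ (large_and _ _ Hz H9)) as [x [Hx [Hx1 Hx2]]].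
    specialize (Hx2 _ Hx1); unfold avoid in Hx2; rewrite app_lam in Hx2.
    * apply in_sep in Hx2; tauto.
    * apply (ord_trans k x); auto.
(* Almost all [x] lie above a given [z]: single points are small by nonprincipality, and
   completeness discards all the points below [z] together. *)
- rewrite <- (ult_fix z Hz); unfold j at 1; apply Hmem; [apply Mconst; eauto..|].
  assert (Hne : forall a, a ∈ k -> large (fun x => app d x <> a)).
  { intros a Ha; apply large_neg; [apply Meq; eauto|]; intro H.
    destruct HW as [_ [_ [_ [_ [_ [_ [H7 _]]]]]]]; apply (H7 a Ha).
    replace (upair a a) with (sep k (fun x => app d x = a)); [auto|].
    apply ext; intro x; rewrite in_sep, in_sing; split.
    - intros [Hx E]; rewrite Had in E; auto.
    - intros ->; rewrite Had; auto. }
  destruct HW as [_ [_ [_ [_ [_ [_ [_ [H8 _]]]]]]]].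
  assert (H' : forall a, a ∈ z -> app (avoid d z) a ∈ W).
  { intros a Ha; unfold avoid; rewrite app_lam by auto.
    apply Hne; apply (ord_trans k z); auto. }
  assert (Mz : M z) by eauto.
  specialize (H8 z Hz _ (Mavoid d z Mid Mz) (lam_fun _ _) H').
  refine (large_mono _ _ _ (large_and _ _ (Hne z Hz) H8) _).
  { apply (DefT_closed M (fun _ e => sep (e 0) (fun x => app (e 1) x ∈ x))
      (scons k (fun _ => const k z))); [auto|def|].
    apply envin_scons; [auto|]; apply envin_cst, Mconst; auto. }
  intros x Hx [H1 H2]; rewrite app_const by auto; rewrite Had in H1 by auto.
  destruct (ord_total z x) as [H|[H|H]]; eauto using ord_mem; [now destruct H1|].
  specialize (H2 x H); unfold avoid in H2; rewrite app_lam in H2 by auto.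
  apply in_sep in H2 as [_ H2]; destruct H2; auto.
Qed.

(** Łoś for the formula that equates a set with the value of a function at an argument, evaluated at
    [g], the constant function [g] and the identity, whose class is [k] by [ult_seed]. *)
Lemma ult_rep g : M g -> is_fun g k -> c g = app (j g) k.
Proof.
intros Mg Hg.
assert (HD : Def (fun (M : cls) (e : nat -> V) => e 0 = app (e 1) (e 2))) by def.
destruct HD as [p Hp].
set (ev := scons g (scons (const k g) (fun _ => lam k (fun x => x)))).
assert (Hev : forall n, M (ev n) /\ is_fun (ev n) k).
{ intros [|[|n]]; simpl; auto; split; [auto|apply lam_fun]. }
assert (HL := los p ev Hev).
rewrite (Hp N) in HL; [|apply ult_good|].
2: { intro n; apply Hc; exists (ev n); auto. }
simpl in HL; rewrite ult_seed in HL; apply HL.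
apply large_true; intros x Hx; apply Hp; auto.
- intro n; apply (DefT_closed M (fun _ e => app (e 0) (e 1)) (scons (ev n) (fun _ => x)));
    [auto|def|apply envin_scons; [apply Hev|apply envin_cst; eauto]].
- simpl; rewrite app_const, app_lam; auto.
Qed.

Lemma ult_crit_mem : k ∈ j k.
Proof.
assert (H : c (lam k (fun x => x)) ∈ j k); [|now rewrite ult_seed in H].
apply c_const_mem; [auto|apply lam_fun|auto|].
apply large_true; intros x Hx; now rewrite app_lam.
Qed.

(** Everything below [k] is fixed, while [k] belongs to its own image and so is moved. *)
Lemma ult_crit i k' : (forall x, M x -> i x = j x) -> critical_point M i k' -> k' = k.
Proof.
intros Hi [Ho [Mk' [Hne Hlt]]].
destruct (ord_total k' k Ho Hk) as [H|[H|H]]; [|auto|].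
- destruct Hne; rewrite Hi, ult_fix; auto.
- specialize (Hlt k H); rewrite Hi in Hlt by auto.
  destruct (mem_irrefl k); rewrite <- Hlt at 2; apply ult_crit_mem.
Qed.

End Ultrapower.

(** * The iteration: elementarity, fixed ordinals, generation by the critical points *)

Section Iteration.
Context {V : zfc}.
Notation cls := (V -> Prop).
Context (kappa alpha : V) (U : V -> V) (M : V -> V -> Prop) (pi : V -> V -> V -> V).
Context (Hkappa : ordinal kappa) (Halpha : alpha ∈ kappa).
Context (HU : forall g, g ∈ alpha -> normal_ultrafilter kappa (U g)).
Context (Hiter : iteration kappa alpha U M pi).

Let Hal : ordinal alpha := ord_mem kappa alpha Hkappa Halpha.

Lemma le_ord x : x ∈ succ alpha -> ordinal x.
Proof. apply (ord_mem _ _ (ord_succ _ Hal)). Qed.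

Lemma le_lt y x : y ∈ succ alpha -> x ∈ y -> x ∈ alpha.
Proof.
intros Hy Hx; apply in_succ in Hy as [Hy| ->]; [|auto].
apply (ord_trans alpha y); auto.
Qed.

Lemma lt_le x : x ∈ alpha -> x ∈ succ alpha.
Proof. rewrite in_succ; auto. Qed.

Lemma succ_le xi : xi ∈ alpha -> succ xi ∈ succ alpha.
Proof.
intro Hxi; apply in_succ; destruct (ord_total (succ xi) alpha) as [H|[H|H]]; auto.
- apply ord_succ, le_ord, lt_le; auto.
- apply in_succ in H as [H| ->]; [destruct (mem_asym _ _ H Hxi)|destruct (mem_irrefl _ Hxi)].
Qed.

Lemma succ_trans (x y z : V) : ordinal z -> x ∈ succ y -> y ∈ succ z -> x ∈ succ z.
Proof.
intros Hz Hx Hy; rewrite in_succ in *; destruct Hx as [Hx| ->]; [|auto].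
left; destruct Hy as [Hy| ->]; [apply (ord_trans z y); auto|auto].
Qed.

Lemma empty_le (x : V) : ordinal x -> empty ∈ succ x.
Proof.
induction (mem_wf x) as [x _ IH]; intro Hx; apply in_succ.
destruct (classic (exists y, y ∈ x)) as [[y Hy]|H].
- left; specialize (IH y Hy (ord_mem x y Hx Hy)); apply in_succ in IH as [H| ->]; [|auto].
  apply (ord_trans x y); auto.
- right; apply ext; intro y; split; intro Hy.
  + destruct (not_in_empty _ Hy).
  + destruct H; eauto.
Qed.

Lemma self_le (x : V) : x ∈ succ x.
Proof. apply in_succ; auto. Qed.

Let pi_id xi x : xi ∈ succ alpha -> M xi x -> pi xi xi x = x.
Proof. exact (proj1 (proj2 Hiter) xi x). Qed.

(** The induction invariant. The definition of the iteration states neither elementarity nor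
    commutation between arbitrary stages, so both are carried along. *)
Definition good_stage xi : Prop :=
  trans_class (M xi) /\
  (forall zeta, zeta ∈ succ xi -> elem (M zeta) (M xi) (pi zeta xi)) /\
  (forall zeta eta x, eta ∈ succ xi -> zeta ∈ succ eta -> M zeta x ->
     pi zeta xi x = pi eta xi (pi zeta eta x)).

Lemma M_empty : M empty = top.
Proof.
apply functional_extensionality; intro x; apply propositional_extensionality.
split; [easy|]; intros _; exact (proj1 Hiter x).
Qed.

Lemma stage_good xi : xi ∈ succ alpha -> good_stage xi -> good (M xi).
Proof.
intros Hxi [Ht [He _]].
apply (elem_good (M empty) _ (pi empty xi)); [|rewrite M_empty; apply good_top|auto|].
- exists empty; now rewrite M_empty.
- apply He, empty_le, le_ord; auto.
Qed.

Lemma stage_facts xi : xi ∈ alpha -> good_stage xi ->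
  let k := pi empty xi kappa in let W := pi empty xi (U xi) in
  good (M xi) /\ M xi k /\ normal_in (M xi) k W /\ ordinal k.
Proof.
intros Hxi Hg k W; assert (Hg' := stage_good xi (lt_le _ Hxi) Hg).
destruct Hg as [Ht [He _]].
assert (Hj : elem top (M xi) (pi empty xi)).
{ rewrite <- M_empty; apply He, empty_le, le_ord, lt_le; auto. }
split; [auto|split; [apply Hj; easy|split]].
- apply (Def_elem top (M xi) _ _ (scons kappa (fun _ => U xi)) good_top Hg' Hj Def_normal_in);
    [easy|]; simpl; apply normal_in_top; auto.
- apply (Def_elem top (M xi) _ _ (fun _ => kappa) good_top Hg' Hj Def_ordinal); [easy|]; auto.
Qed.

Lemma stage_succ xi : xi ∈ alpha -> exists c,
  ultrapower (M xi) (pi empty xi kappa) (pi empty xi (U xi)) c (M (succ xi)) /\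
  forall x, M xi x -> pi xi (succ xi) x = c (const (pi empty xi kappa) x).
Proof. intros Hxi; apply (proj1 (proj2 (proj2 Hiter)) xi Hxi). Qed.

Lemma good_stage_succ xi : xi ∈ alpha ->
  (forall eta, eta ∈ succ xi -> good_stage eta) -> good_stage (succ xi).
Proof.
intros Hxi IH.
assert (Hs := succ_le xi Hxi).
assert (Hg := IH xi (self_le xi)).
destruct (stage_facts xi Hxi Hg) as [HM [Mk [HW Hk]]].
destruct (stage_succ xi Hxi) as [c [Hc Hpi]].
assert (Hcom : forall zeta x, zeta ∈ succ xi -> M zeta x ->
  pi zeta (succ xi) x = pi xi (succ xi) (pi zeta xi x)) by exact (proj2 (proj1 (proj2 (proj2 Hiter)) xi Hxi)).
assert (Helem : elem (M xi) (M (succ xi)) (pi xi (succ xi))).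
{ apply (elem_comp _ _ _ (fun x => x) _ _ (elem_id _ _ (fun x _ => eq_refl))
    (ult_elem _ _ _ _ _ HM Mk HW Hc)); auto. }
destruct Hg as [Ht [He Hco]].
assert (He' : forall zeta, zeta ∈ succ (succ xi) ->
  elem (M zeta) (M (succ xi)) (pi zeta (succ xi))).
{ intros zeta Hz; apply in_succ in Hz as [Hz| ->].
  - apply (elem_comp _ _ _ _ _ _ (He zeta Hz) Helem); auto.
  - apply elem_id; auto. }
split; [exact (proj1 Hc)|split; [auto|]].
intros zeta eta x Heta Hzeta Hx; apply in_succ in Heta as [Heta| ->].
- assert (Hze : zeta ∈ succ xi)
    by (apply (succ_trans zeta eta); auto using le_ord, lt_le).
  assert (Hle : M eta (pi zeta eta x)) by (apply (IH eta Heta); auto).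
  rewrite (Hcom zeta), (Hcom eta), (Hco zeta eta); auto.
- rewrite (pi_id (succ xi)); auto; apply He'; auto.
Qed.

Lemma max_le (x y a : V) : ordinal a -> x ∈ a -> y ∈ a ->
  exists z, z ∈ a /\ x ∈ succ z /\ y ∈ succ z.
Proof.
intros Ha Hx Hy.
destruct (ord_total x y (ord_mem _ _ Ha Hx) (ord_mem _ _ Ha Hy)) as [H|[->|H]];
  [exists y|exists y|exists x]; rewrite !in_succ; auto.
Qed.

(** Elementarity into a direct limit goes by induction on formulas, for all stages [z] at once: an
    element of the limit comes from some stage [m] not before [z], and the map from [z] to [m] is
    already elementary. *)
Lemma good_stage_limit lam : lam ∈ succ alpha -> limit lam ->
  (forall eta, eta ∈ lam -> good_stage eta) -> good_stage lam.
Proof.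
intros Hl Hlim IH.
destruct (proj2 (proj2 (proj2 Hiter)) lam Hl Hlim) as [Ht [HN [Heq Hmem]]].
assert (Hlo : ordinal lam) by (apply le_ord; auto).
assert (Hle : forall z, z ∈ lam -> z ∈ succ alpha).
{ intros z Hz; apply lt_le, (le_lt _ _ Hl Hz). }
assert (Hto : forall z x, z ∈ lam -> M z x -> M lam (pi z lam x)).
{ intros z x Hz Hx; apply HN; exists (z, x); auto. }
assert (Hmap : forall z h x, h ∈ lam -> z ∈ succ h -> M z x -> M h (pi z h x)).
{ intros z h x Hh Hz Hx; apply (IH h Hh); auto. }
assert (Hlt : forall z h, h ∈ lam -> z ∈ succ h -> z ∈ lam).
{ intros z h Hh Hz; apply in_succ in Hz as [Hz| ->]; [apply (ord_trans lam h)|]; auto. }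
(* An element and its image at a later stage represent the same thread. *)
assert (Hcom : forall z h x, h ∈ lam -> z ∈ succ h -> M z x ->
  pi z lam x = pi h lam (pi z h x)).
{ intros z h x Hh Hz Hx.
  apply (Heq (z, x) (h, pi z h x)); simpl; [eauto|eauto|].
  exists h; split; [auto|split; [auto|split; [apply self_le|]]].
  rewrite (pi_id h); auto. }
assert (Hel : forall p z e, z ∈ lam -> envin (M z) e ->
  (sat (M z) p e <-> sat (M lam) p (fun n => pi z lam (e n)))).
{ induction p; simpl; intros z e Hz He.
  - rewrite (Hmem (z, e i) (z, e j)) by (split; simpl; auto); simpl; split.
    + intro H; exists z; rewrite !pi_id; auto using self_le.
    + intros [h [Hh [Hzh [_ H]]]].
      apply (elem_mem _ _ _ _ _ (proj1 (proj2 (IH h Hh)) z Hzh)); auto.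
  - rewrite (Heq (z, e i) (z, e j)) by (split; simpl; auto); simpl; split.
    + intro H; exists z; rewrite !pi_id; auto using self_le.
    + intros [h [Hh [Hzh [_ H]]]].
      apply (elem_eq _ _ _ _ _ (proj1 (proj2 (IH h Hh)) z Hzh)); auto.
  - tauto.
  - rewrite (IHp1 z e), (IHp2 z e); tauto.
  - split.
    + intros H y Hy; apply HN in Hy as [[h y'] [[Hh Hy'] <-]]; simpl in *.
      destruct (max_le z h lam Hlo Hz Hh) as [m [Hm [Hzm Hhm]]].
      assert (Hall : sat (M m) (Fall p) (fun n => pi z m (e n))).
      { apply (proj1 (proj2 (IH m Hm)) z Hzm); auto. }
      specialize (Hall (pi h m y') (Hmap _ _ _ Hm Hhm Hy')).
      apply IHp in Hall; [|auto|apply envin_scons; auto; intro n; auto].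
      revert Hall; apply sat_bound; intros [|n] _; simpl; rewrite Hcom with (h := m); auto.
    + intros H x Hx; specialize (H (pi z lam x) (Hto _ _ Hz Hx)).
      apply IHp; [auto|apply envin_scons; auto|].
      revert H; apply sat_bound; intros [|n] _; reflexivity. }
split; [auto|split].
- intros z Hz; apply in_succ in Hz as [Hz| ->]; [split; auto|apply elem_id; auto].
- intros z h x Hh Hz Hx; apply in_succ in Hh as [Hh| ->]; [auto|].
  rewrite (pi_id lam); auto.
  apply in_succ in Hz as [Hz| ->]; [auto|rewrite pi_id; auto].
Qed.

Lemma stages xi : xi ∈ succ alpha -> good_stage xi.
Proof.
induction (mem_wf xi) as [xi _ IH]; intro Hxi.
assert (IH' : forall eta, eta ∈ xi -> good_stage eta).
{ intros eta H; apply IH; [auto|]; apply lt_le, (le_lt xi); auto. }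
destruct (ord_cases xi (le_ord xi Hxi)) as [->|[[b ->]|Hlim]].
- split; [rewrite M_empty; easy|split].
  + intros z Hz; apply in_succ in Hz as [Hz| ->]; [destruct (not_in_empty _ Hz)|].
    apply elem_id; auto.
  + intros z h x Hh Hz Hx; apply in_succ in Hh as [Hh| ->]; [destruct (not_in_empty _ Hh)|].
    apply in_succ in Hz as [Hz| ->]; [destruct (not_in_empty _ Hz)|].
    rewrite !pi_id; auto; now rewrite pi_id.
- apply good_stage_succ; [|auto]; apply (le_lt (succ b)); auto using self_le.
- apply good_stage_limit; auto.
Qed.

Lemma M_good xi : xi ∈ succ alpha -> good (M xi).
Proof. intro H; apply stage_good, stages; auto. Qed.

Lemma pi_elem zeta xi : xi ∈ succ alpha -> zeta ∈ succ xi ->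
  elem (M zeta) (M xi) (pi zeta xi).
Proof. intros Hxi; apply (stages xi Hxi). Qed.

Lemma pi_comp zeta eta xi x : xi ∈ succ alpha -> eta ∈ succ xi -> zeta ∈ succ eta ->
  M zeta x -> pi zeta xi x = pi eta xi (pi zeta eta x).
Proof. intros Hxi; apply (stages xi Hxi). Qed.

Lemma j_elem xi : xi ∈ succ alpha -> elem top (M xi) (pi empty xi).
Proof.
intro H; rewrite <- M_empty; apply pi_elem, empty_le, le_ord; auto.
Qed.

Lemma j_kappa_ord xi : xi ∈ succ alpha -> ordinal (pi empty xi kappa).
Proof.
intro Hxi; apply (Def_elem top (M xi) _ _ (fun _ => kappa) good_top (M_good xi Hxi)
  (j_elem xi Hxi) Def_ordinal); [easy|]; auto.
Qed.

(** Induction on the last stage. A successor step fixes everything below its measurable cardinal by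
    [ult_fix]; a limit stage takes a further induction on [b]. *)
Lemma pi_fix xi zeta b : xi ∈ succ alpha -> zeta ∈ succ xi ->
  b ∈ pi empty zeta kappa -> pi zeta xi b = b.
Proof.
revert zeta b; induction (mem_wf xi) as [xi _ IH]; intros zeta b Hxi Hz Hb.
assert (Hmem : forall z y, z ∈ succ alpha -> y ∈ pi empty z kappa -> M z y).
{ intros z y Hz' Hy; apply (proj1 (M_good z Hz') (pi empty z kappa)); [|auto].
  apply j_elem; easy. }
assert (Hza : zeta ∈ succ alpha) by (apply (succ_trans zeta xi alpha); auto).
assert (Mb : M zeta b) by (apply Hmem; auto).
apply in_succ in Hz as [Hz| ->]; [|apply pi_id; auto].
destruct (ord_cases xi (le_ord xi Hxi)) as [->|[[x ->]|Hlim]].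
- destruct (not_in_empty _ Hz).
- assert (Hx : x ∈ alpha) by (apply (le_lt (succ x)); auto using self_le).
  assert (Hx' := lt_le x Hx).
  assert (Hzx : pi zeta x b = b) by (apply IH; auto using self_le).
  assert (Hbx : b ∈ pi empty x kappa).
  { rewrite <- Hzx, (pi_comp empty zeta x); auto; [|apply empty_le, le_ord; auto|].
    - refine (proj1 (elem_mem _ _ _ b _ (pi_elem zeta x Hx' Hz) Mb _) Hb).
      apply j_elem; easy.
    - now rewrite M_empty. }
  rewrite (pi_comp zeta x (succ x)), Hzx; auto using self_le.
  2: apply in_succ; left; apply self_le.
  destruct (stage_facts x Hx (stages x Hx')) as [HM [Mk [HW Hk]]].
  destruct (stage_succ x Hx) as [c [Hc Hpi]].
  rewrite Hpi by (apply Hmem; auto).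
  apply (ult_fix _ _ _ _ _ HM Mk HW Hk Hc); auto.
- assert (Hlo := le_ord xi Hxi).
  revert Hb Mb; induction (mem_wf b) as [b _ IHb]; intros Hb Mb.
  destruct (proj2 (proj2 (proj2 Hiter)) xi Hxi Hlim) as [Ht [HN _]].
  assert (Hsub : forall y, y ∈ b -> y ∈ pi empty zeta kappa).
  { intros y Hy; apply (ord_trans _ b); auto; apply j_kappa_ord; auto. }
  assert (Hzs : zeta ∈ succ xi) by (apply in_succ; auto).
  assert (Hel := pi_elem zeta xi Hxi Hzs).
  apply ext; intro y; split; intro Hy.
  + assert (My : M xi y) by (apply (Ht (pi zeta xi b)); [apply Hel|]; auto).
    (* [y] is the image of some [x'] from a stage [m] at or after [zeta]. Since [b] is fixed up to
       [m], elementarity puts [x'] into [b], and then [x'] is fixed as well. *)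
    apply HN in My as [[h x] [[Hh Hx] E]]; simpl in *.
    destruct (max_le zeta h xi Hlo Hz Hh) as [m [Hm [Hzm Hhm]]].
    assert (Hma : m ∈ succ alpha) by (apply lt_le, (le_lt xi); auto).
    assert (Hms : m ∈ succ xi) by (apply in_succ; auto).
    rewrite (pi_comp h m xi) in E by auto.
    assert (Mx : M m (pi h m x)) by (apply (pi_elem h m); auto).
    set (x' := pi h m x) in *.
    assert (Hb' : pi zeta m b = b) by (apply IH; auto).
    assert (Hx' : x' ∈ b).
    { rewrite <- Hb'; apply (elem_mem _ _ _ _ _ (pi_elem m xi Hxi Hms)); auto.
      - apply (pi_elem zeta m); auto.
      - rewrite E, <- pi_comp; auto. }
    assert (Hx'' : pi zeta m x' = x') by (apply IH; auto).
    assert (Mzx : M zeta x') by (apply Hmem; auto).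
    rewrite <- E, <- Hx'', <- pi_comp, (IHb x' Hx'); auto.
  + rewrite <- (IHb y Hy); auto.
    apply (proj1 (elem_mem _ _ _ y b Hel (Hmem _ _ Hza (Hsub y Hy)) Mb)); auto.
Qed.

Section Critical.
Context (kap : V -> V).
Context (Hcrit : forall g, g ∈ alpha -> critical_point (M g) (pi g (succ g)) (kap g)).

Lemma kap_eq xi : xi ∈ alpha -> kap xi = pi empty xi kappa.
Proof.
intro Hxi.
destruct (stage_facts xi Hxi (stages xi (lt_le xi Hxi))) as [HM [Mk [HW Hk]]].
destruct (stage_succ xi Hxi) as [c [Hc Hpi]].
apply (ult_crit _ _ _ _ _ HM Mk HW Hk Hc _ _ Hpi); auto.
Qed.

(** Makes [pi_fix] applicable to [kap xi] from stage [succ xi] on. *)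
Lemma kap_lt xi : xi ∈ alpha -> kap xi ∈ pi empty (succ xi) kappa.
Proof.
intro Hxi; assert (Hs := succ_le xi Hxi).
destruct (stage_facts xi Hxi (stages xi (lt_le xi Hxi))) as [HM [Mk [HW Hk]]].
destruct (stage_succ xi Hxi) as [c [Hc Hpi]].
rewrite (pi_comp empty xi (succ xi)), kap_eq; auto.
- rewrite Hpi by auto; apply (ult_crit_mem _ _ _ _ _ HM Mk HW Hk Hc).
- apply in_succ; left; apply self_le.
- apply empty_le, le_ord, lt_le; auto.
- now rewrite M_empty.
Qed.

Lemma kap_in_succ xi : xi ∈ alpha -> M (succ xi) (kap xi).
Proof.
intro Hxi; assert (Hs := succ_le xi Hxi).
apply (proj1 (M_good _ Hs) (pi empty (succ xi) kappa)); [apply j_elem; easy|].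
now apply kap_lt.
Qed.

Lemma kap_fix xi : xi ∈ alpha -> M alpha (kap xi) /\ pi (succ xi) alpha (kap xi) = kap xi.
Proof.
intro Hxi; assert (Hs := succ_le xi Hxi).
assert (E : pi (succ xi) alpha (kap xi) = kap xi).
{ apply pi_fix; auto using self_le, kap_lt. }
split; [|auto]; rewrite <- E.
apply (pi_elem (succ xi) alpha); auto using self_le, kap_in_succ.
Qed.

(** The last model is generated from the image of the universe by evaluation at critical points:
    [ult_rep] handles successor stages, later embeddings fix [kap xi], and every element of a limit
    stage comes from an earlier one. *)
Lemma stage_ind (Q : V -> Prop) :
  (forall x, Q (pi empty alpha x)) ->
  (forall xi g, xi ∈ alpha -> Q g -> Q (app g (kap xi))) ->
  forall x, M alpha x -> Q x.
Proof.
intros H0 HS.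
enough (G : forall xi, xi ∈ succ alpha -> forall x, M xi x -> Q (pi xi alpha x)).
{ intros x Hx; rewrite <- (pi_id alpha) by auto using self_le; auto using self_le. }
intro xi; induction (mem_wf xi) as [xi _ IH]; intros Hxi x Hx.
destruct (ord_cases xi (le_ord xi Hxi)) as [->|[[b ->]|Hlim]].
- auto.
- assert (Hb : b ∈ alpha) by (apply (le_lt (succ b)); auto using self_le).
  assert (Hb' := lt_le b Hb).
  destruct (stage_facts b Hb (stages b Hb')) as [HM [Mk [HW Hk]]].
  destruct (stage_succ b Hb) as [c [Hc Hpi]].
  destruct (proj1 (proj1 (proj2 Hc) x) Hx) as [g [[Mg Hg] <-]].
  rewrite (ult_rep _ _ _ _ _ HM Mk HW Hk Hc g Mg Hg), <- Hpi, <- (kap_eq b Hb) by auto.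
  assert (Hel := pi_elem (succ b) alpha (self_le _) Hxi).
  assert (Hstep := pi_elem b (succ b) Hxi ltac:(apply in_succ; left; apply self_le)).
  assert (Mkb := kap_in_succ b Hb).
  rewrite (elem_app _ _ _ _ _ (M_good _ Hxi) (M_good _ (self_le _)) Hel); auto.
  + rewrite (proj2 (kap_fix b Hb)); apply HS; [auto|].
    rewrite <- (pi_comp b (succ b) alpha); auto using self_le.
    apply in_succ; left; apply self_le.
  + apply Hstep; auto.
- destruct (proj2 (proj2 (proj2 Hiter)) xi Hxi Hlim) as [_ [HN _]].
  apply HN in Hx as [[h y] [[Hh Hy] <-]]; simpl in *.
  rewrite <- (pi_comp h xi alpha); auto using self_le.
  + apply IH; auto; apply lt_le, (le_lt xi); auto.
  + apply in_succ; auto.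
Qed.

End Critical.
End Iteration.

(** * Calculus of complete Boolean algebras and of names *)

Section Boolean.
Context {V : zfc}.
Context (B le : V) (HB : complete_boolean_algebra B le).

Notation "a ≤ b" := (pair a b ∈ le) (at level 70).
Notation sup := (bsup B le).
Notation inf := (binf B le).
Notation meet := (bmeet B le).
Notation join := (bjoin B le).
Notation compl := (bcompl B le).
Notation imp := (bimp B le).
Notation zero := (bzero B le).
Notation one := (bone B le).

Lemma ble_refl a : a ∈ B -> a ≤ a.
Proof. apply HB. Qed.

Lemma ble_anti a b : a ∈ B -> b ∈ B -> a ≤ b -> b ≤ a -> a = b.
Proof. apply HB. Qed.

Lemma ble_trans a b c : a ∈ B -> b ∈ B -> c ∈ B -> a ≤ b -> b ≤ c -> a ≤ c.
Proof. apply HB. Qed.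

Lemma sup_spec X : (forall x, X x -> x ∈ B) -> is_sup B le X (sup X).
Proof.
intro HX; destruct HB as [_ [_ [_ [H _]]]]; destruct (proj1 (H X HX)) as [b Hb].
unfold bsup; rewrite (the_eq B _ b); [auto|apply Hb|auto|].
intros y Hy Hy'; destruct Hb as [Hb [Hb1 Hb2]], Hy' as [_ [Hy1 Hy2]].
apply ble_anti; auto.
Qed.

Lemma inf_spec X : (forall x, X x -> x ∈ B) -> is_inf B le X (inf X).
Proof.
intro HX; destruct HB as [_ [_ [_ [H _]]]]; destruct (proj2 (H X HX)) as [b Hb].
unfold binf; rewrite (the_eq B _ b); [auto|apply Hb|auto|].
intros y Hy Hy'; destruct Hb as [Hb [Hb1 Hb2]], Hy' as [_ [Hy1 Hy2]].
apply ble_anti; auto.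
Qed.

Lemma in_sup X : (forall x, X x -> x ∈ B) -> sup X ∈ B.
Proof. intro H; apply (sup_spec X H). Qed.

Lemma in_inf X : (forall x, X x -> x ∈ B) -> inf X ∈ B.
Proof. intro H; apply (inf_spec X H). Qed.

Lemma le_sup X c x : (forall x, X x -> x ∈ B) -> c ∈ B -> X x -> c ≤ x -> c ≤ sup X.
Proof.
intros HX Hc Hx H; destruct (sup_spec X HX) as [H1 [H2 _]].
apply (ble_trans c x); auto.
Qed.

Lemma le_inf X c : (forall x, X x -> x ∈ B) -> c ∈ B ->
  (c ≤ inf X <-> forall x, X x -> c ≤ x).
Proof.
intros HX Hc; destruct (inf_spec X HX) as [H1 [H2 H3]]; split; [|auto].
intros H x Hx; apply (ble_trans c (inf X)); auto.
Qed.

Lemma in_zero : zero ∈ B.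
Proof. apply in_sup; easy. Qed.

Lemma zero_le a : a ∈ B -> zero ≤ a.
Proof. intro Ha; apply (sup_spec (fun _ => False)); easy. Qed.

Lemma in_one : one ∈ B.
Proof. apply in_inf; easy. Qed.

Lemma le_one a : a ∈ B -> a ≤ one.
Proof. intro Ha; apply (inf_spec (fun _ => False)); easy. Qed.

Let two a b : a ∈ B -> b ∈ B -> forall x, x = a \/ x = b -> x ∈ B.
Proof. intros Ha Hb x [->| ->]; auto. Qed.

Lemma in_meet a b : a ∈ B -> b ∈ B -> meet a b ∈ B.
Proof. intros Ha Hb; exact (in_inf _ (two a b Ha Hb)). Qed.

Lemma in_join a b : a ∈ B -> b ∈ B -> join a b ∈ B.
Proof. intros Ha Hb; exact (in_sup _ (two a b Ha Hb)). Qed.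

Lemma le_meet a b c : a ∈ B -> b ∈ B -> c ∈ B -> (c ≤ meet a b <-> c ≤ a /\ c ≤ b).
Proof.
intros Ha Hb Hc; unfold bmeet; rewrite (le_inf _ c (two a b Ha Hb) Hc); split; [auto|].
intros [H1 H2] x [->| ->]; auto.
Qed.

Lemma join_le a b c : a ∈ B -> b ∈ B -> c ∈ B -> a ≤ c -> b ≤ c -> join a b ≤ c.
Proof.
intros Ha Hb Hc H1 H2; apply (sup_spec _ (two a b Ha Hb)); auto; intros x [->| ->]; auto.
Qed.

Lemma le_join_l a b : a ∈ B -> b ∈ B -> a ≤ join a b.
Proof. intros Ha Hb; apply (le_sup _ _ a (two a b Ha Hb)); auto using ble_refl. Qed.

Lemma le_join_r a b : a ∈ B -> b ∈ B -> b ≤ join a b.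
Proof. intros Ha Hb; apply (le_sup _ _ b (two a b Ha Hb)); auto using ble_refl. Qed.

Lemma meet_le_l a b : a ∈ B -> b ∈ B -> meet a b ≤ a.
Proof. intros; apply (le_meet a b); auto using ble_refl, in_meet. Qed.

Lemma meet_le_r a b : a ∈ B -> b ∈ B -> meet a b ≤ b.
Proof. intros; apply (le_meet a b); auto using ble_refl, in_meet. Qed.

(** Distributivity as a proof by cases below [c]. *)
Let distr c a b d : a ∈ B -> b ∈ B -> c ∈ B -> d ∈ B -> c ≤ join a b ->
  meet c a ≤ d -> meet c b ≤ d -> c ≤ d.
Proof.
intros Ha Hb Hc Hd H H1 H2.
apply (ble_trans c (meet c (join a b))); auto using in_meet, in_join.
- apply le_meet; auto using in_join, ble_refl.
- destruct HB as [_ [_ [_ [_ [HD _]]]]]; rewrite HD by auto.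
  apply join_le; auto using in_meet.
Qed.

Lemma compl_spec a : a ∈ B -> compl a ∈ B /\ meet a (compl a) = zero /\ join a (compl a) = one.
Proof.
intro Ha; destruct HB as [_ [_ [_ [_ [_ [H _]]]]]].
destruct (H a Ha) as [b [Hb [H1 H2]]].
unfold bcompl; rewrite (the_eq B _ b); auto.
enough (G : forall b c, b ∈ B -> c ∈ B -> meet a b = zero -> join a c = one -> b ≤ c).
{ intros y Hy [Hy1 Hy2]; apply ble_anti; auto. }
clear b Hb H1 H2; intros b c Hb Hc E1 E2.
apply (distr b a c); auto.
- rewrite E2; apply le_one; auto.
- apply (ble_trans _ zero); auto using in_meet, in_zero, zero_le.
  rewrite <- E1; apply le_meet; auto using in_meet, meet_le_l, meet_le_r.
- apply meet_le_r; auto.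
Qed.

Lemma in_compl a : a ∈ B -> compl a ∈ B.
Proof. apply compl_spec. Qed.

Lemma le_compl c a : c ∈ B -> a ∈ B -> meet c a ≤ zero -> c ≤ compl a.
Proof.
intros Hc Ha H; destruct (compl_spec a Ha) as [Ha' [E1 E2]].
apply (distr c a (compl a)); auto.
- rewrite E2; apply le_one; auto.
- apply (ble_trans _ zero); auto using in_meet, in_zero, zero_le.
- apply meet_le_r; auto.
Qed.

Lemma in_imp a b : a ∈ B -> b ∈ B -> imp a b ∈ B.
Proof. intros; apply in_join; auto using in_compl. Qed.

(** The adjunction between meet and implication, tested on all [d] below [c], so that it reads as
    the forcing clause for implication. *)
Lemma le_imp c a b : a ∈ B -> b ∈ B -> c ∈ B ->
  (c ≤ imp a b <-> forall d, d ∈ B -> d ≤ c -> d ≤ a -> d ≤ b).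
Proof.
intros Ha Hb Hc; destruct (compl_spec a Ha) as [Ha' [E1 E2]].
unfold bimp; split.
- intros H d Hd Hdc Hda.
  apply (distr d (compl a) b); auto using meet_le_r.
  + apply (ble_trans d c); auto using in_join.
  + apply (ble_trans _ zero); auto using in_meet, in_zero, zero_le.
    rewrite <- E1; apply le_meet; auto using in_meet, meet_le_r.
    split; [|auto using meet_le_r].
    apply (ble_trans _ d); auto using in_meet, meet_le_l.
- intro H; apply (distr c a (compl a)); auto using in_join.
  + rewrite E2; apply le_one; auto.
  + apply (ble_trans _ b); auto using in_meet, in_join, le_join_r.
    apply H; auto using in_meet, meet_le_l, meet_le_r.
  + apply (ble_trans _ (compl a)); auto using in_meet, in_join, le_join_l, meet_le_r.
Qed.

(** Only finite distributivity is assumed. The infinite law comes from [le_imp]: the element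
    [imp c b] is an upper bound of [X], hence above [sup X] and above [c]. *)
Lemma sup_elim X c b : (forall x, X x -> x ∈ B) -> c ∈ B -> b ∈ B -> c ≤ sup X ->
  (forall x d, X x -> d ∈ B -> d ≤ c -> d ≤ x -> d ≤ b) -> c ≤ b.
Proof.
intros HX Hc Hb H HE.
apply (proj1 (le_imp (sup X) c b Hc Hb (in_sup X HX))); auto using ble_refl.
apply (sup_spec X HX); [apply in_imp; auto|].
intros x Hx; apply le_imp; auto.
intros d Hd Hdx Hdc; apply (HE x d); auto.
Qed.

(** * Boolean-valued equality and membership *)

Notation EQ := (bv_eq B le).
Notation MEM := (bv_mem B le).
Notation chk := (check B le).

Lemma name_in s r b : is_name B s -> pair r b ∈ s -> is_name B r /\ b ∈ B.
Proof.
intros [H] Hr; destruct (H _ Hr) as [r' [b' [E [Hb Hn]]]].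
apply pair_inj in E as [-> ->]; auto.
Qed.

Lemma in_EQ s t : is_name B s -> is_name B t -> EQ s t ∈ B.
Proof.
revert t; induction (in_name_dom_wf s) as [s _ IH]; intros t Hs Ht.
assert (IH' : forall r b r' b', pair r b ∈ s -> pair r' b' ∈ t ->
  EQ r r' ∈ B /\ b ∈ B /\ b' ∈ B).
{ intros r b r' b' H H'; destruct (name_in _ _ _ Hs H), (name_in _ _ _ Ht H').
  split; [apply IH; [now exists b|auto|auto]|auto]. }
rewrite bv_eq_unfold; apply in_meet; apply in_inf.
- intros x [r [b [H ->]]]; apply in_imp; [apply (name_in _ _ _ Hs H)|].
  apply in_sup; intros y [r' [b' [H' ->]]].
  apply in_meet; [apply (name_in _ _ _ Ht H')|]; apply (IH' _ _ _ _ H H').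
- intros x [r' [b' [H' ->]]]; apply in_imp; [apply (name_in _ _ _ Ht H')|].
  apply in_sup; intros y [r [b [H ->]]].
  apply in_meet; [apply (name_in _ _ _ Hs H)|]; apply (IH' _ _ _ _ H H').
Qed.

Lemma mem_set r t : is_name B r -> is_name B t ->
  forall y, (exists r' b', pair r' b' ∈ t /\ y = meet b' (EQ r r')) -> y ∈ B.
Proof.
intros Hr Ht y [r' [b' [H ->]]]; destruct (name_in _ _ _ Ht H).
apply in_meet; auto using in_EQ.
Qed.

Lemma mem_set' s r' : is_name B s -> is_name B r' ->
  forall y, (exists r b, exists _ : pair r b ∈ s, y = meet b (EQ r r')) -> y ∈ B.
Proof.
intros Hs Hr y [r [b [H ->]]]; destruct (name_in _ _ _ Hs H).
apply in_meet; auto using in_EQ.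
Qed.

Lemma in_MEM r t : is_name B r -> is_name B t -> MEM r t ∈ B.
Proof. intros; apply in_sup, mem_set; auto. Qed.

Lemma MEM_intro r t r' b' c : is_name B r -> is_name B t -> c ∈ B ->
  pair r' b' ∈ t -> c ≤ b' -> c ≤ EQ r r' -> c ≤ MEM r t.
Proof.
intros Hr Ht Hc H H1 H2; destruct (name_in _ _ _ Ht H).
apply (le_sup _ _ (meet b' (EQ r r')) (mem_set r t Hr Ht) Hc); [now exists r', b'|].
apply le_meet; auto using in_EQ.
Qed.

Lemma MEM_elim r t c d : is_name B r -> is_name B t -> c ∈ B -> d ∈ B -> c ≤ MEM r t ->
  (forall r' b' a, pair r' b' ∈ t -> a ∈ B -> a ≤ c -> a ≤ b' -> a ≤ EQ r r' -> a ≤ d) ->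
  c ≤ d.
Proof.
intros Hr Ht Hc Hd H HE; apply (sup_elim _ _ _ (mem_set r t Hr Ht) Hc Hd H).
intros x a [r' [b' [H' ->]]] Ha Hac Hax; destruct (name_in _ _ _ Ht H').
apply le_meet in Hax as [Hax1 Hax2]; auto using in_EQ; eauto.
Qed.

(** The value of [r'] belonging to [s], with equality in the order in which [bv_eq_unfold] produces
    it; symmetry of [EQ] is proved only afterwards. *)
Let RMEM s r' := sup (fun y => exists r b, exists _ : pair r b ∈ s, y = meet b (EQ r r')).

Let RMEM_intro s r r' b c : is_name B r' -> is_name B s -> c ∈ B ->
  pair r b ∈ s -> c ≤ b -> c ≤ EQ r r' -> c ≤ RMEM s r'.
Proof.
intros Hr Hs Hc H H1 H2; destruct (name_in _ _ _ Hs H).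
apply (le_sup _ _ (meet b (EQ r r')) (mem_set' s r' Hs Hr) Hc); [now exists r, b, H|].
apply le_meet; auto using in_EQ.
Qed.

Let RMEM_elim s r' c d : is_name B r' -> is_name B s -> c ∈ B -> d ∈ B -> c ≤ RMEM s r' ->
  (forall r b a, pair r b ∈ s -> a ∈ B -> a ≤ c -> a ≤ b -> a ≤ EQ r r' -> a ≤ d) ->
  c ≤ d.
Proof.
intros Hr Hs Hc Hd H HE; apply (sup_elim _ _ _ (mem_set' s r' Hs Hr) Hc Hd H).
intros x a [r [b [H' ->]]] Ha Hac Hax; destruct (name_in _ _ _ Hs H').
apply le_meet in Hax as [Hax1 Hax2]; auto using in_EQ; eauto.
Qed.

(** The forcing clause for extensionality, obtained by unfolding infima and implications; it
    replaces [bv_eq_unfold] from here on. *)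
Lemma le_EQ s t c : is_name B s -> is_name B t -> c ∈ B -> (c ≤ EQ s t <->
  (forall r b d, pair r b ∈ s -> d ∈ B -> d ≤ c -> d ≤ b -> d ≤ MEM r t) /\
  (forall r' b' d, pair r' b' ∈ t -> d ∈ B -> d ≤ c -> d ≤ b' -> d ≤ RMEM s r')).
Proof.
intros Hs Ht Hc; rewrite bv_eq_unfold.
assert (H1 : forall x, (exists r b (_ : pair r b ∈ s), x = imp b (MEM r t)) -> x ∈ B).
{ intros x [r [b [H ->]]]; destruct (name_in _ _ _ Hs H); apply in_imp; auto using in_MEM. }
assert (H2 : forall x, (exists r' b', pair r' b' ∈ t /\ x = imp b' (RMEM s r')) -> x ∈ B).
{ intros x [r' [b' [H ->]]]; destruct (name_in _ _ _ Ht H); apply in_imp; auto.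
  apply in_sup, mem_set'; auto. }
rewrite le_meet, !le_inf; auto using in_inf; split.
- intros [H3 H4]; split.
  + intros r b d H Hd; destruct (name_in _ _ _ Hs H).
    apply (le_imp c b); auto using in_MEM; eauto.
  + intros r' b' d H Hd; destruct (name_in _ _ _ Ht H).
    apply (le_imp c b'); auto; [apply in_sup, mem_set'; auto|]; apply H4; eauto.
- intros [H3 H4]; split.
  + intros x [r [b [H ->]]]; destruct (name_in _ _ _ Hs H).
    apply le_imp; auto using in_MEM; eauto.
  + intros x [r' [b' [H ->]]]; destruct (name_in _ _ _ Ht H).
    apply le_imp; auto; [apply in_sup, mem_set'; auto|]; eauto.
Qed.

Lemma EQ_refl s c : is_name B s -> c ∈ B -> c ≤ EQ s s.
Proof.
revert c; induction (in_name_dom_wf s) as [s _ IH]; intros c Hs Hc; apply le_EQ; auto.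
split; intros r b d H Hd Hdc Hdb; destruct (name_in _ _ _ Hs H);
  [apply (MEM_intro r s r b)|apply (RMEM_intro s r r b)]; auto; apply IH; auto; now exists b.
Qed.

Lemma EQ_sym s t c : is_name B s -> is_name B t -> c ∈ B -> c ≤ EQ s t -> c ≤ EQ t s.
Proof.
revert t c; induction (in_name_dom_wf s) as [s _ IH]; intros t c Hs Ht Hc H.
apply le_EQ in H as [H1 H2]; auto; apply le_EQ; auto; split.
- intros r' b' d H Hd Hdc Hdb; destruct (name_in _ _ _ Ht H).
  apply (RMEM_elim s r' d _); auto using in_MEM; [apply (H2 r' b'); auto|].
  intros r b a H' Ha Had Hab Hae; destruct (name_in _ _ _ Hs H').
  apply (MEM_intro r' s r b); auto; apply IH; auto; now exists b.
- intros r b d H Hd Hdc Hdb; destruct (name_in _ _ _ Hs H).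
  apply (MEM_elim r t d _); auto; [apply in_sup, mem_set'; auto|apply (H1 r b); auto|].
  intros r' b' a H' Ha Had Hab Hae; destruct (name_in _ _ _ Ht H').
  apply (RMEM_intro t r' r b'); auto; apply IH; auto; now exists b.
Qed.

Lemma EQ_trans s t u c : is_name B s -> is_name B t -> is_name B u -> c ∈ B ->
  c ≤ EQ s t -> c ≤ EQ t u -> c ≤ EQ s u.
Proof.
revert t u c; induction (in_name_dom_wf s) as [s _ IH]; intros t u c Hs Ht Hu Hc H H'.
apply le_EQ in H as [H1 H2]; auto; apply le_EQ in H' as [H3 H4]; auto.
apply le_EQ; auto; split.
- intros r b d H Hd Hdc Hdb; destruct (name_in _ _ _ Hs H).
  apply (MEM_elim r t d _); auto using in_MEM; [apply (H1 r b); auto|].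
  intros r' b' a H' Ha Had Hab Hae; destruct (name_in _ _ _ Ht H').
  apply (MEM_elim r' u a _); auto using in_MEM.
  { apply (H3 r' b'); auto; apply (ble_trans a d c); auto. }
  intros r2 b2 a2 H2' Ha2 Ha2a Hab2 Hae2; destruct (name_in _ _ _ Hu H2').
  apply (MEM_intro r u r2 b2); auto.
  apply (IH r ltac:(now exists b) r'); auto.
  apply (ble_trans a2 a); auto using in_EQ.
- intros r2 b2 d H Hd Hdc Hdb; destruct (name_in _ _ _ Hu H).
  assert (HR : RMEM s r2 ∈ B) by (apply in_sup, mem_set'; auto).
  apply (RMEM_elim t r2 d _); auto; [apply (H4 r2 b2); auto|].
  intros r' b' a H' Ha Had Hab Hae; destruct (name_in _ _ _ Ht H').
  apply (RMEM_elim s r' a _); auto.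
  { apply (H2 r' b'); auto; apply (ble_trans a d c); auto. }
  intros r b a2 H2' Ha2 Ha2a Hab2 Hae2; destruct (name_in _ _ _ Hs H2').
  apply (RMEM_intro s r r2 b); auto.
  apply (IH r ltac:(now exists b) r'); auto.
  apply (ble_trans a2 a); auto using in_EQ.
Qed.

Lemma MEM_eq_l r r' t c : is_name B r -> is_name B r' -> is_name B t -> c ∈ B ->
  c ≤ EQ r r' -> c ≤ MEM r' t -> c ≤ MEM r t.
Proof.
intros Hr Hr' Ht Hc H H'.
apply (MEM_elim r' t c _); auto using in_MEM.
intros q b a Hq Ha Hac Hab Hae; destruct (name_in _ _ _ Ht Hq).
apply (MEM_intro r t q b); auto; apply (EQ_trans r r' q); auto.
apply (ble_trans a c); auto using in_EQ.
Qed.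

Lemma MEM_eq_r r t u c : is_name B r -> is_name B t -> is_name B u -> c ∈ B ->
  c ≤ MEM r t -> c ≤ EQ t u -> c ≤ MEM r u.
Proof.
intros Hr Ht Hu Hc H H'.
apply (MEM_elim r t c _); auto using in_MEM.
intros q b a Hq Ha Hac Hab Hae; destruct (name_in _ _ _ Ht Hq).
apply (MEM_eq_l r q); auto.
apply le_EQ in H' as [HE _]; auto; apply (HE q b); auto.
Qed.

Lemma in_check z x : z ∈ chk x <-> exists y, y ∈ x /\ z = pair (chk y) one.
Proof.
unfold check at 1; rewrite Fix_eq.
- rewrite in_repl; split.
  + intros [[y Hy] E]; simpl in E; eauto.
  + intros [y [Hy ->]]; now exists (exist _ y Hy).
- intros w g h Hgh; f_equal; apply functional_extensionality; intros [y Hy]; simpl.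
  now rewrite Hgh.
Qed.

Lemma name_check x : is_name B (chk x).
Proof.
induction (mem_wf x) as [x _ IH]; constructor; intros z Hz.
apply in_check in Hz as [y [Hy ->]]; exists (chk y), one; auto using in_one.
Qed.

Lemma check_MEM x y c : c ∈ B -> x ∈ y -> c ≤ MEM (chk x) (chk y).
Proof.
intros Hc H; apply (MEM_intro _ _ (chk x) one); auto using name_check, le_one, EQ_refl.
apply in_check; eauto.
Qed.

(** By induction, a nonzero element below the value of [chk z = chk w] gives [z = w]. If [z] is in
    just one of [x] and [y], no such nonzero element lies below [c] for a [w] in the other, which
    forces [c] to be zero. *)
Lemma EQ_check x y c : c ∈ B -> ~ c ≤ zero -> c ≤ EQ (chk x) (chk y) -> x = y.
Proof.
revert y c; induction (mem_wf x) as [x _ IH]; intros y c Hc Hc0 H.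
apply le_EQ in H as [H1 H2]; auto using name_check.
apply ext; intro z; split; intro Hz; apply NNPP; intro Hn; apply Hc0.
- apply (MEM_elim (chk z) (chk y) c _); auto using name_check, in_zero.
  + apply (H1 _ one); auto using ble_refl, le_one; apply in_check; eauto.
  + intros r b a Hr Ha Hac _ Hae; apply in_check in Hr as [w [Hw E]].
    apply pair_inj in E as [-> ->].
    apply NNPP; intro Ha0; apply Hn; now rewrite (IH z Hz w a).
- apply (RMEM_elim (chk x) (chk z) c _); auto using name_check, in_zero.
  + apply (H2 _ one); auto using ble_refl, le_one; apply in_check; eauto.
  + intros r b a Hr Ha Hac _ Hae; apply in_check in Hr as [w [Hw E]].
    apply pair_inj in E as [-> ->].
    apply NNPP; intro Ha0; apply Hn; now rewrite <- (IH w Hw z a).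
Qed.

Lemma MEM_check x y c : c ∈ B -> ~ c ≤ zero -> c ≤ MEM (chk x) (chk y) -> x ∈ y.
Proof.
intros Hc Hc0 H; apply NNPP; intro Hn; apply Hc0.
apply (MEM_elim (chk x) (chk y) c _); auto using name_check, in_zero.
intros r b a Hr Ha Hac _ Hae; apply in_check in Hr as [w [Hw E]].
apply pair_inj in E as [-> ->].
apply NNPP; intro Ha0; apply Hn; now rewrite (EQ_check x w a).
Qed.

Section Decided.
Context (s t x y c : V) (Hs : is_name B s) (Ht : is_name B t).
Context (Hc : c ∈ B) (Hc0 : ~ c ≤ zero).
Context (Hsx : c ≤ EQ s (chk x)) (Hty : c ≤ EQ t (chk y)).

Lemma EQ_decided : c ≤ EQ s t <-> x = y.
Proof.
split.
- intro H; apply (EQ_check x y c); auto.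
  apply (EQ_trans _ s); auto using name_check, EQ_sym.
  apply (EQ_trans _ t); auto using name_check.
- intros <-; apply (EQ_trans _ (chk x)); auto using name_check, EQ_sym.
Qed.

Lemma MEM_decided : c ≤ MEM s t <-> x ∈ y.
Proof.
split; intro H.
- apply (MEM_check x y c); auto.
  apply (MEM_eq_l _ s); auto using name_check, EQ_sym.
  apply (MEM_eq_r _ t); auto using name_check.
- apply (MEM_eq_l _ (chk x)); auto using name_check.
  apply (MEM_eq_r _ (chk y)); auto using name_check, EQ_sym, check_MEM.
Qed.

End Decided.

(* The usual mixture of the names [check (h i)] with the Boolean values [b i]. *)
Definition mix (I : V) (b h : V -> V) : V :=
  union (repl I (fun i => repl (h (proj1_sig i)) (fun z => pair (chk (proj1_sig z)) (b (proj1_sig i))))).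

Lemma in_mix z I b h : z ∈ mix I b h <->
  exists i y, i ∈ I /\ y ∈ h i /\ z = pair (chk y) (b i).
Proof.
unfold mix; rewrite in_union; split.
- intros [w [Hz Hw]]; apply in_repl in Hw as [[i Hi] ->]; simpl in Hz.
  apply in_repl in Hz as [[y Hy] ->]; simpl; eauto.
- intros [i [y [Hi [Hy ->]]]].
  exists (repl (h i) (fun z => pair (chk (proj1_sig z)) (b i))); split; apply in_repl.
  + now exists (exist _ y Hy).
  + now exists (exist _ i Hi).
Qed.

Lemma name_mix I b h : (forall i, i ∈ I -> b i ∈ B) -> is_name B (mix I b h).
Proof.
intro Hb; constructor; intros z Hz; apply in_mix in Hz as [i [y [Hi [_ ->]]]].
exists (chk y), (b i); auto using name_check.
Qed.

(** Below [b i], another index [k] contributes either nothing, when [b k] is disjoint from the part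
    considered, or elements of the same set [h i]. *)
Lemma EQ_mix I b h i : (forall i, i ∈ I -> b i ∈ B) ->
  (forall i k d, i ∈ I -> k ∈ I -> d ∈ B -> d ≤ b i -> d ≤ b k -> d ≤ zero \/ h i = h k) ->
  i ∈ I -> b i ≤ EQ (mix I b h) (chk (h i)).
Proof.
intros Hb Hcomp Hi; assert (Hn := name_mix I b h Hb).
apply le_EQ; auto using name_check; split.
- intros r a d Hr Hd Hdi Hda; apply in_mix in Hr as [k [y [Hk [Hy E]]]].
  apply pair_inj in E as [-> ->].
  destruct (Hcomp i k d) as [H0|E]; auto.
  + apply (ble_trans d zero); auto using in_zero, in_MEM, name_check, zero_le.
  + apply check_MEM; [auto|now rewrite E].
- intros r a d Hr Hd Hdi Hda; apply in_check in Hr as [y [Hy E]].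
  apply pair_inj in E as [-> ->].
  apply (RMEM_intro _ (chk y) _ (b i)); auto using name_check, EQ_refl.
  apply in_mix; eauto.
Qed.

End Boolean.

(** * The order of Magidor conditions, and shrinking of measure one sets *)

Section Magidor.
Context {V : zfc}.

(** The projections are written with quantifiers bounded by [union p], so that they are definable
    and commute with the embedding. *)
Definition pfst (p : V) : V :=
  the (union p) (fun s => exists T, T ∈ union p /\ p = pair s T).
Definition psnd (p : V) : V :=
  the (union p) (fun T => exists s, s ∈ union p /\ p = pair s T).

Lemma pair_components (x y : V) : x ∈ union (pair x y) /\ y ∈ union (pair x y).
Proof.
split; apply in_union; exists (upair x y); unfold pair; rewrite !in_upair; auto.
Qed.

Lemma pfst_pair (x y : V) : pfst (pair x y) = x.
Proof.
destruct (pair_components x y) as [Hx Hy].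
apply the_eq; [auto|eauto|]; intros z _ [T [_ E]]; now apply pair_inj in E as [-> _].
Qed.

Lemma psnd_pair (x y : V) : psnd (pair x y) = y.
Proof.
destruct (pair_components x y) as [Hx Hy].
apply the_eq; [auto|eauto|]; intros z _ [T [_ E]]; now apply pair_inj in E as [_ ->].
Qed.

Lemma DefT_pfst t : DefT t -> DefT (fun M (e : nat -> V) => pfst (t M e)).
Proof. intro Ht; unfold pfst, the; def. Qed.

Lemma DefT_psnd t : DefT t -> DefT (fun M (e : nat -> V) => psnd (t M e)).
Proof. intro Ht; unfold psnd, the; def. Qed.

Lemma normal_remove (k W X x : V) : normal_ultrafilter k W -> X ∈ W -> diff X (upair x x) ∈ W.
Proof.
intros [[H1 [_ [_ [_ [H5 H6]]]]] [H7 _]] HX.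
destruct (classic (x ∈ k)) as [Hx|Hx].
- destruct (H6 (upair x x)) as [H|H].
  + intros y Hy; now apply in_sing in Hy as ->.
  + destruct (H7 x Hx H).
  + replace (diff X (upair x x)) with (sep X (fun y => y ∈ diff k (upair x x))); [auto|].
    apply ext; intro y; rewrite in_sep, !in_diff; split; [tauto|].
    intros [Hy Hn]; repeat split; auto; apply (H1 X); auto.
- replace (diff X (upair x x)) with X; [auto|].
  apply ext; intro y; rewrite in_diff, in_sing; split; [|tauto].
  intro Hy; split; [auto|intros ->; apply Hx, (H1 X); auto].
Qed.

Context (kappa alpha : V) (U : V -> V) (f : V -> V -> V).
Context (HU : forall g, g ∈ alpha -> normal_ultrafilter kappa (U g)).

Notation P := (magidor kappa alpha U f).
Notation leP := (magidor_order kappa alpha U f).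

Lemma in_magidor_order r p : pair r p ∈ leP -> r ∈ P /\ p ∈ P /\ pfst p ⊆ pfst r.
Proof.
intro H; apply in_sep in H as [H1 [s' [T' [s [T [E [Hs _]]]]]]].
apply pair_in_prod in H1 as [Hr Hp].
apply pair_inj in E as [-> ->]; rewrite !pfst_pair; auto.
Qed.

Lemma magidor_fun p : p ∈ P -> is_fun (pfst p) (dom (pfst p)).
Proof.
intro H; apply in_sep in H as [_ [s [T [-> Hc]]]]; rewrite pfst_pair; apply Hc.
Qed.

Lemma magidor_refl p : p ∈ P -> pair p p ∈ leP.
Proof.
intro Hp; apply in_sep; split; [now apply pair_in_prod|].
apply in_sep in Hp as [_ [s [T [-> _]]]].
exists s, T, s, T; repeat split; auto.
intros b Hb; apply in_diff in Hb; tauto.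
Qed.

(* The ultrafilters are nonprincipal, so [x] can be removed from all measure one sets. *)
Lemma magidor_shrink p xi x : p ∈ P -> xi ∈ alpha ->
  exists d, d ∈ P /\ pair d p ∈ leP /\ (xi ∈ dom (pfst d) \/ x ∉ app (psnd d) xi).
Proof.
intros Hp Hxi; assert (Hp' := Hp); apply in_sep in Hp' as [Hamb [s [T [-> Hc]]]].
apply pair_in_prod in Hamb as [Hsa HTa].
set (T' := lam (diff alpha (dom s)) (fun b => diff (app T b) (upair x x))).
destruct Hc as [C1 [C2 [C3 [C4 [C5 [C6 C7]]]]]].
assert (HT' : forall b, b ∈ diff alpha (dom s) -> app T' b = diff (app T b) (upair x x)).
{ intros b Hb; unfold T'; now rewrite app_lam. }
assert (Hd : pair s T' ∈ P).
{ apply in_sep; split.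
  - apply pair_in_prod; split; [auto|]; apply in_power; intros z Hz.
    apply in_lam in Hz as [b [Hb ->]]; apply pair_in_prod.
    assert (Hpa := pair_app T _ b C6 Hb).
    apply (proj1 (in_power _ _ _) HTa), pair_in_prod in Hpa as [Hb1 Hb2].
    split; [auto|]; apply in_power; intros y Hy; apply in_diff in Hy as [Hy _].
    apply (proj1 (in_power _ _ _) Hb2); auto.
  - exists s, T'; split; [auto|].
    do 5 (split; [assumption|]); split; [apply lam_fun|].
    intros b Hb; destruct (C7 b Hb) as [D1 [D2 D3]]; rewrite HT' by auto.
    split; [|split].
    + intro H; apply (normal_remove kappa); [|auto]; apply HU; apply in_diff in Hb; tauto.
    (* The stem entry at [g] lies in the set A for [g], so the value of [f g b] there is a normal
       ultrafilter. *)
    + intros g Hg Hbg Hmin; apply (normal_remove (app s g)); [|auto].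
      specialize (C5 g Hg); apply in_sep in C5 as [_ [_ [C5 _]]]; auto.
    + intros g Hg Hgb Hmax y Hy; apply in_diff in Hy as [Hy _]; eauto. }
exists (pair s T'); split; [auto|split].
- apply in_sep; split; [now apply pair_in_prod|].
  exists s, T', s, T; split; [auto|split; [auto|split]].
  + intros b Hb; apply in_diff in Hb; tauto.
  + intros b Hb y Hy; rewrite HT' in Hy by auto; now apply in_diff in Hy.
- rewrite pfst_pair, psnd_pair; destruct (classic (xi ∈ dom s)) as [H|H]; [auto|right].
  rewrite HT' by now apply in_diff.
  rewrite in_diff, in_sing; tauto.
Qed.

End Magidor.

(** * Local functions and their values along the generic filter *)

Section Generic.
Context {V : zfc}.
Notation cls := (V -> Prop).
Context (N : cls) (j : V -> V) (P le : V) (G : V -> Prop).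
Context (HN : good N) (Hj : elem top N j) (HG : generic N (j P) (j le) G).
Context (P_in : forall r p, pair r p ∈ le -> r ∈ P).

Lemma transfer (Q : cls -> (nat -> V) -> Prop) e :
  Def Q -> Q top e -> Q N (fun n => j (e n)).
Proof.
intros HQ H; apply (Def_elem top N j Q e good_top HN Hj HQ); [easy|auto].
Qed.

Lemma j_sub X Y : X ⊆ Y -> j X ⊆ j Y.
Proof.
intro H; apply (transfer (fun _ e => forall x, x ∈ e 0 -> x ∈ e 1) (scons X (fun _ => Y)));
  [def|auto].
Qed.

(** Pulls the generic filter back to sets of conditions in the universe, where density and inclusion
    can be checked. *)
Definition hits X : Prop := exists p, G p /\ p ∈ j X.

Definition dense X : Prop := X ⊆ P /\ forall p, p ∈ P -> exists d, d ∈ X /\ pair d p ∈ le.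
Definition open X : Prop := X ⊆ P /\ forall p, p ∈ X -> forall r, pair r p ∈ le -> r ∈ X.

Lemma hits_dense X : dense X -> hits X.
Proof.
intros [HX HD]; destruct HG as [_ [_ [_ [_ Hg]]]].
destruct (Hg (j X)) as [d [Hd Gd]]; [apply Hj; easy|now apply j_sub| |].
- apply (transfer (fun _ e => forall p, p ∈ e 0 -> exists d, d ∈ e 1 /\ pair d p ∈ e 2)
    (scons P (scons X (fun _ => le)))); [def|exact HD].
- exists d; auto.
Qed.

Lemma hits_mono X Y : X ⊆ Y -> hits X -> hits Y.
Proof. intros H [p [Gp Hp]]; exists p; split; [auto|]; now apply (j_sub X Y). Qed.

Lemma hits_nonempty X : hits X -> exists p, p ∈ X.
Proof.
intros [p [_ Hp]]; apply NNPP; intro H.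
apply (transfer (fun _ e => forall x, x ∈ e 0 -> False) (fun _ => X) ltac:(def)
  ltac:(intros x Hx; apply H; eauto) p Hp).
Qed.

Lemma hits_cup X Y : hits (cup X Y) -> hits X \/ hits Y.
Proof.
intros [p [Gp Hp]].
assert (H : p ∈ j X \/ p ∈ j Y).
{ apply (transfer (fun _ e => forall x, x ∈ e 0 -> x ∈ e 1 \/ x ∈ e 2)
    (scons (cup X Y) (scons X (fun _ => Y)))); [def| |exact Hp].
  intros x Hx; now apply in_cup. }
destruct H; [left|right]; exists p; auto.
Qed.

Lemma j_open X r p : open X -> p ∈ j X -> r ∈ j P -> pair r p ∈ j le -> r ∈ j X.
Proof.
intros [_ HX] Hp Hr Hrp; revert p Hp r Hr Hrp.
apply (transfer (fun _ e => forall p, p ∈ e 0 -> forall r, r ∈ e 1 -> pair r p ∈ e 2 -> r ∈ e 0)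
  (scons X (scons P (fun _ => le)))); [def|simpl; eauto].
Qed.

Lemma G_P p : G p -> p ∈ j P.
Proof. apply HG. Qed.

Lemma G_common p q : G p -> G q ->
  exists r, G r /\ r ∈ j P /\ pair r p ∈ j le /\ pair r q ∈ j le.
Proof.
intros Hp Hq; destruct HG as [_ [_ [_ [H _]]]].
destruct (H p q Hp Hq) as [r [Hr Hr']]; exists r; auto using G_P.
Qed.

Lemma hits_inter X Y : open X -> open Y -> hits X -> hits Y ->
  hits (sep X (fun p => p ∈ Y)).
Proof.
intros HX HY [p [Gp Hp]] [q [Gq Hq]].
destruct (G_common p q Gp Gq) as [r [Gr [Pr [Hrp Hrq]]]].
exists r; split; [auto|].
apply (transfer (fun _ e => forall x, x ∈ e 0 -> x ∈ e 1 -> x ∈ e 2)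
  (scons X (scons Y (fun _ => sep X (fun p => p ∈ Y))))); [def| |exact (j_open X r p HX Hp Pr Hrp)|
  exact (j_open Y r q HY Hq Pr Hrq)].
simpl; intros; now apply in_sep.
Qed.

(* Local functions stand for names of ground model elements, and [val h y] says that [y] is
   the value of such a name. *)
Definition local h : Prop :=
  is_fun h (dom h) /\ open (dom h) /\
  forall p, p ∈ dom h -> forall r, pair r p ∈ le -> app h r = app h p.

Definition val h y : Prop := exists p, G p /\ p ∈ j (dom h) /\ app (j h) p = y.

Lemma val_below h p q : local h -> p ∈ j (dom h) -> q ∈ j P -> pair q p ∈ j le ->
  q ∈ j (dom h) /\ app (j h) q = app (j h) p.
Proof.
intros [_ [Ho Hh]] Hp Hq Hqp; split; [exact (j_open _ _ _ Ho Hp Hq Hqp)|].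
apply (transfer (fun _ e => forall p, p ∈ e 0 -> forall r, r ∈ e 1 -> pair r p ∈ e 2 ->
  app (e 3) r = app (e 3) p) (scons (dom h) (scons P (scons le (fun _ => h))))); [def|..]; simpl; auto.
Qed.

Lemma val_unique h y p : local h -> val h y -> G p -> p ∈ j (dom h) -> app (j h) p = y.
Proof.
intros Hh [q [Gq [Hq <-]]] Gp Hp.
destruct (G_common p q Gp Gq) as [r [Gr [Pr [Hrp Hrq]]]].
rewrite <- (proj2 (val_below h p r Hh Hp Pr Hrp)).
apply (val_below h q r Hh Hq Pr Hrq).
Qed.

(** Both values can be read off at one condition of the filter, a common extension inside both
    domains; elementarity then identifies the conditions at which the relation holds. *)
Lemma val_rel (R : V -> V -> Prop) h h' y y' :
  Def (fun (_ : cls) e => R (e 0) (e 1)) ->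
  local h -> local h' -> val h y -> val h' y' ->
  (R y y' <-> hits (sep (dom h) (fun p => p ∈ dom h' /\ R (app h p) (app h' p)))).
Proof.
intros HR Hh Hh' Hy Hy'.
assert (HR' : forall t u : cls -> (nat -> V) -> V, DefT t -> DefT u ->
  Def (fun M e => R (t M e) (u M e))).
{ intros t u Ht Hu; apply (Def_term (fun M e x => R x (u M e))); [auto|].
  apply (Def_term (fun M e x => R (e 0) x)); [def|].
  exact (Def_ren (scons 1 (fun _ => 0)) _ HR). }
set (X := sep (dom h) _).
set (e := scons (dom h) (scons (dom h') (scons h (scons h' (fun _ => X))))).
split.
- intro H; assert (Hy2 := Hy); assert (Hy2' := Hy').
  destruct Hy2 as [p [Gp [Hp _]]], Hy2' as [q [Gq [Hq _]]].
  destruct (G_common p q Gp Gq) as [r [Gr [Pr [Hrp Hrq]]]].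
  assert (Hr := proj1 (val_below h p r Hh Hp Pr Hrp)).
  assert (Hr' := proj1 (val_below h' q r Hh' Hq Pr Hrq)).
  rewrite <- (val_unique h y r Hh Hy Gr Hr), <- (val_unique h' y' r Hh' Hy' Gr Hr') in H.
  exists r; split; [auto|].
  refine (transfer (fun _ e => forall x, x ∈ e 0 -> x ∈ e 1 ->
    R (app (e 2) x) (app (e 3) x) -> x ∈ e 4) e _ _ r Hr Hr' H).
  + apply Def_ball; [def|]; apply Def_imp; [def|]; apply Def_imp; [apply HR'; def|def].
  + simpl; intros x Hx Hx' H'; now apply in_sep.
- intros [p [Gp Hp]].
  assert (H : p ∈ j (dom h) /\ p ∈ j (dom h') /\ R (app (j h) p) (app (j h') p)).
  { refine (transfer (fun _ e => forall x, x ∈ e 4 -> x ∈ e 0 /\ x ∈ e 1 /\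
      R (app (e 2) x) (app (e 3) x)) e _ _ p Hp).
    - apply Def_ball; [def|]; repeat (apply Def_and; [def|]); apply HR'; def.
    - simpl; intros x Hx; now apply in_sep in Hx. }
  destruct H as [H1 [H2 H3]].
  now rewrite (val_unique h y p Hh Hy Gp H1), (val_unique h' y' p Hh' Hy' Gp H2) in H3.
Qed.

Lemma val_in h y : val h y -> N y.
Proof.
intros [p [Gp [Hp <-]]].
apply (DefT_closed N (fun _ e => app (e 0) (e 1)) (scons (j h) (fun _ => p))); [auto|def|].
apply envin_scons; [apply Hj; easy|apply envin_cst].
apply (proj1 HN (j P)); [apply Hj; easy|now apply G_P].
Qed.

Lemma val_ex h : hits (dom h) -> exists y, val h y.
Proof. intros [p [Gp Hp]]; exists (app (j h) p), p; auto. Qed.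

Lemma val_hits h y : val h y -> hits (dom h).
Proof. intros [p [Gp [Hp _]]]; exists p; auto. Qed.

Lemma dom_lam A (F : V -> V) : dom (lam A F) = A.
Proof. apply dom_fun, lam_fun. Qed.

Lemma local_const x : local (lam P (fun _ => x)) /\ val (lam P (fun _ => x)) (j x).
Proof.
split.
- split; [rewrite dom_lam; apply lam_fun|rewrite dom_lam; split; [split; eauto|]].
  intros p Hp r Hr; rewrite !app_lam; eauto.
- destruct HG as [_ [[p Gp] _]]; exists p; split; [auto|].
  rewrite dom_lam; split; [now apply G_P|].
  refine (transfer (fun _ e => forall p, p ∈ e 0 -> app (e 1) p = e 2)
    (scons P (scons (lam P (fun _ => x)) (fun _ => x))) _ _ p (G_P p Gp)); [def|].
  simpl; intros q Hq; now rewrite app_lam.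
Qed.

(** If [h] stands for a function, this stands for its value at the stem entry at [xi], which along
    the filter of the theorem is [kap xi]. *)
Definition coord h xi : V :=
  lam (sep (dom h) (fun p => xi ∈ dom (pfst p))) (fun p => app (app h p) (app (pfst p) xi)).

(** Stems only grow along the order, so an entry once present never changes. *)
Lemma local_coord h xi :
  (forall p, p ∈ P -> is_fun (pfst p) (dom (pfst p))) ->
  (forall r p, pair r p ∈ le -> pfst p ⊆ pfst r) ->
  local h -> local (coord h xi).
Proof.
intros Hfun Hsub [Hf [[HoP Ho] Hh]].
assert (Hd : forall p r, p ∈ P -> pair r p ∈ le -> xi ∈ dom (pfst p) ->
  xi ∈ dom (pfst r) /\ app (pfst r) xi = app (pfst p) xi).
{ intros p r Hp Hr Hx; assert (Hpa := pair_app _ _ _ (Hfun p Hp) Hx).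
  apply (Hsub r p Hr) in Hpa; split; [apply in_dom; eauto|].
  apply (app_pair _ _ _ _ (Hfun r (P_in r p Hr)) Hpa). }
unfold local, coord; rewrite dom_lam; split; [apply lam_fun|split; [split|]].
- intros p Hp; apply in_sep in Hp as [Hp _]; auto.
- intros p Hp r Hr; apply in_sep in Hp as [Hp Hx]; apply in_sep; split; [eauto|].
  apply (Hd p r); auto.
- intros p Hp r Hr; assert (Hp' := Hp); apply in_sep in Hp' as [Hp' Hx].
  destruct (Hd p r) as [Hx' E]; auto.
  rewrite !app_lam; [|auto|apply in_sep; eauto].
  now rewrite E, (Hh p Hp' r Hr).
Qed.

Lemma val_coord h xi y p :
  local h -> val h y -> G p -> p ∈ j (dom h) -> j xi ∈ dom (pfst p) ->
  val (coord h xi) (app y (app (pfst p) (j xi))).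
Proof.
intros Hh Hy Gp Hp Hx; exists p; split; [auto|].
assert (Hx' : p ∈ j (dom (coord h xi))).
{ refine (transfer (fun _ e => forall p, p ∈ e 0 -> e 1 ∈ dom (pfst p) -> p ∈ e 2)
    (scons (dom h) (scons xi (fun _ => dom (coord h xi)))) _ _ p Hp Hx).
  - apply Def_ball; [def|]; apply Def_imp; [apply Def_mem; [def|apply DefT_dom, DefT_pfst; def]|def].
  - simpl; intros q Hq Hqx; unfold coord; rewrite dom_lam; now apply in_sep. }
split; [auto|].
rewrite <- (val_unique h y p Hh Hy Gp Hp).
refine (transfer (fun _ e => forall p, p ∈ e 0 ->
   app (e 1) p = app (app (e 2) p) (app (pfst p) (e 3)))
  (scons (dom (coord h xi)) (scons (coord h xi) (scons h (fun _ => xi)))) _ _ p Hx').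
- apply Def_ball; [def|]; apply Def_eq; [def|].
  apply DefT_app; [def|apply DefT_app; [apply DefT_pfst; def|def]].
- simpl; intros q Hq; unfold coord in *; rewrite dom_lam in Hq; now rewrite app_lam.
Qed.

(* No condition can avoid committing itself on the coordinate [xi]: otherwise [k] could be
   removed from its measure one set, against genericity. *)
Lemma coord_hits xi k :
  (forall p x, p ∈ P -> exists d, d ∈ P /\ pair d p ∈ le /\
     (xi ∈ dom (pfst d) \/ x ∉ app (psnd d) xi)) ->
  N k -> (forall p, G p -> j xi ∈ dom (pfst p) \/ k ∈ app (psnd p) (j xi)) ->
  exists p, G p /\ j xi ∈ dom (pfst p).
Proof.
intros HD Nk Hk.
set (D := sep (j P) (fun p => j xi ∈ dom (pfst p) \/ k ∉ app (psnd p) (j xi))).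
assert (Hdef : forall a b c : cls -> (nat -> V) -> V, DefT a -> DefT b -> DefT c ->
  Def (fun M e => a M e ∈ dom (pfst (b M e)) \/ c M e ∉ app (psnd (b M e)) (a M e))).
{ intros; apply Def_or; [|apply Def_not]; apply Def_mem; auto.
  - now apply DefT_dom, DefT_pfst.
  - apply DefT_app; [now apply DefT_psnd|auto]. }
(* [k] need not be in the range of [j], so [D] need not be the image of a set; it is in [N] by
   definable separation. *)
assert (ND : N D).
{ apply (DefT_closed N (fun _ e => sep (e 0) (fun p => e 1 ∈ dom (pfst p) \/
    e 2 ∉ app (psnd p) (e 1))) (scons (j P) (scons (j xi) (fun _ => k)))); [auto| |].
  - apply DefT_sep; [def|apply Hdef; def].
  - repeat (apply envin_scons; [apply Hj; easy|]); now apply envin_cst. }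
destruct HG as [_ [_ [_ [_ Hg]]]].
destruct (Hg D ND) as [d [Hd Gd]].
- intros p Hp; now apply in_sep in Hp.
- intros p Hp.
  (* Density is transferred for all [x] simultaneously and only then specialized to [k]. *)
  assert (H : forall x, N x -> forall p, p ∈ j P -> exists d, d ∈ j P /\ pair d p ∈ j le /\
     (j xi ∈ dom (pfst d) \/ x ∉ app (psnd d) (j xi))).
  { refine (transfer (fun M e => forall x, M x -> forall p, p ∈ e 0 -> exists d, d ∈ e 0 /\
      (pair d p ∈ e 1 /\ (e 2 ∈ dom (pfst d) \/ x ∉ app (psnd d) (e 2))))
      (scons P (scons le (fun _ => xi))) _ _).
    - apply Def_all, Def_ball; [def|]; apply Def_bex; [def|]; apply Def_and; [def|].
      apply Hdef; def.
    - simpl; intros x _ q Hq; auto. }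
  destruct (H k Nk p Hp) as [d [Hd [Hdp Hdx]]]; exists d; split; [now apply in_sep|auto].
- exists d; split; [auto|]; apply in_sep in Hd as [_ [Hd|Hd]]; [auto|].
  destruct (Hk d Gd); tauto.
Qed.

End Generic.

(** * The induced ultrafilter and its Boolean ultrapower *)

Section Induced.
Context {V : zfc}.
Notation cls := (V -> Prop).
Context (N : cls) (j : V -> V) (P le : V) (G : V -> Prop) (B leB e : V).
Context (HN : good N) (Hj : elem top N j) (HG : generic N (j P) (j le) G).
Context (P_refl : forall p, p ∈ P -> pair p p ∈ le).
Context (P_in : forall r p, pair r p ∈ le -> r ∈ P).
Context (Hcomp : completion P le B leB e).

Notation "a ≤ b" := (pair a b ∈ leB) (at level 70).
Notation zero := (bzero B leB).
Notation one := (bone B leB).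
Notation compl := (bcompl B leB).
Notation meet := (bmeet B leB).
Notation EQ := (bv_eq B leB).
Notation MEM := (bv_mem B leB).
Notation chk := (check B leB).
Notation ground := (bv_ground B leB).
Notation hits := (hits j G).
Notation val := (val j G).

Let HB : complete_boolean_algebra B leB := proj1 Hcomp.

Let in_e p : p ∈ P -> app e p ∈ B.
Proof. apply Hcomp. Qed.

Let e_pos p : p ∈ P -> ~ app e p ≤ zero.
Proof.
intros Hp H; pose proof Hcomp as [_ [_ [H1 _]]]; apply (H1 p Hp).
apply (ble_anti B leB HB); auto using in_zero, zero_le.
Qed.

Let e_mono r p : pair r p ∈ le -> p ∈ P -> app e r ≤ app e p.
Proof. intros H Hp; pose proof Hcomp as [_ [_ [_ [H1 _]]]]; apply H1; eauto. Qed.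

(** Density gives a condition [q] below the meet. It need not extend [p], but is compatible with it,
    since incompatible conditions have disjoint images; a common extension is taken. *)
Lemma dense_below p b : p ∈ P -> b ∈ B -> ~ meet (app e p) b ≤ zero ->
  exists r, pair r p ∈ le /\ app e r ≤ b.
Proof.
intros Hp Hb H; pose proof Hcomp as [_ [_ [_ [_ [Hinc Hden]]]]].
assert (Hm : meet (app e p) b ∈ B) by (apply in_meet; auto).
destruct (Hden (meet (app e p) b) Hm) as [q [Hq Hqm]].
{ intro E; apply H; rewrite E; apply (ble_refl B leB HB); auto using in_zero. }
apply (le_meet B leB HB) in Hqm as [Hqp Hqb]; auto.
destruct (classic (exists r, r ∈ P /\ pair r p ∈ le /\ pair r q ∈ le)) as [[r [Hr [Hrp Hrq]]]|Hn].
- exists r; split; [auto|]; apply (ble_trans B leB HB _ (app e q)); auto.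
- apply Hinc in Hn; auto; destruct (e_pos q Hq); rewrite <- Hn.
  apply (le_meet B leB HB); auto; split; auto; apply (ble_refl B leB HB); auto.
Qed.

Definition extent b : V := sep P (fun p => app e p ≤ b).

Lemma extent_open b : b ∈ B -> open P le (extent b).
Proof.
intro Hb; split; [intros p Hp; now apply in_sep in Hp|].
intros p Hp r Hr; apply in_sep in Hp as [Hp Hpb]; apply in_sep; split; [eauto|].
apply (ble_trans B leB HB _ (app e p)); eauto.
Qed.

Lemma extent_mono a b : a ∈ B -> b ∈ B -> a ≤ b -> extent a ⊆ extent b.
Proof.
intros Ha Hb H p Hp; apply in_sep in Hp as [Hp Hpa]; apply in_sep; split; [auto|].
apply (ble_trans B leB HB _ a); auto.
Qed.

(** The filter [F] of the theorem. *)
Definition induced : V := sep B (fun b => generated (j B) (j leB) (j e) G (j b)).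

(** By elementarity [j (extent b)] consists of the conditions of [j P] that [j e] maps below
    [j b]. *)
Lemma in_induced b : b ∈ induced <-> b ∈ B /\ hits (extent b).
Proof.
unfold induced; rewrite in_sep; split; intros [Hb H]; (split; [auto|]).
- destruct H as [_ [p [Gp Hp]]]; exists p; split; [auto|].
  refine (transfer N j HN Hj (fun _ v => forall p, p ∈ v 0 -> pair (app (v 1) p) (v 2) ∈ v 3 ->
    p ∈ v 4) (scons P (scons e (scons b (scons leB (fun _ => extent b))))) _ _ p
    (G_P N j P le G HG p Gp) Hp); [def|].
  simpl; intros q Hq Hqb; now apply in_sep.
- destruct H as [p [Gp Hp]]; split.
  + now apply (elem_mem top N j b B Hj).
  + exists p; split; [auto|].
    refine (transfer N j HN Hj (fun _ v => forall p, p ∈ v 4 -> pair (app (v 1) p) (v 2) ∈ v 3)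
      (scons P (scons e (scons b (scons leB (fun _ => extent b))))) _ _ p Hp); [def|].
    simpl; intros q Hq; now apply in_sep in Hq.
Qed.

Lemma extent_decides b p : b ∈ B -> p ∈ P ->
  app e p ≤ compl b \/ exists r, pair r p ∈ le /\ app e r ≤ b.
Proof.
intros Hb Hp; destruct (classic (meet (app e p) b ≤ zero)) as [H|H].
- left; apply (le_compl B leB HB); auto.
- right; apply dense_below; auto.
Qed.

Lemma induced_ultrafilter : boolean_ultrafilter B leB induced.
Proof.
assert (Hne : hits P).
{ destruct HG as [HP [[p Gp] _]]; exists p; auto. }
split; [intros b Hb; now apply in_induced in Hb|].
split; [|split; [|split; [|split]]].
- apply in_induced; split; [apply in_one; auto|].
  apply (hits_mono N j G HN Hj P); [|auto].
  intros p Hp; apply in_sep; split; [auto|apply le_one; auto].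
- intro H; apply in_induced in H as [_ H].
  apply (hits_nonempty N j G HN Hj) in H as [p Hp]; apply in_sep in Hp as [Hp H].
  now apply (e_pos p).
- intros a b Ha Hb H; apply in_induced in Ha as [Ha Ha']; apply in_induced; split; [auto|].
  apply (hits_mono N j G HN Hj _ _ (extent_mono a b Ha Hb H)); auto.
- intros a b Ha Hb; apply in_induced in Ha as [Ha Ha'], Hb as [Hb Hb'].
  apply in_induced; split; [apply in_meet; auto|].
  refine (hits_mono N j G HN Hj _ _ _ (hits_inter N j P le G HN Hj HG _ _
    (extent_open a Ha) (extent_open b Hb) Ha' Hb')).
  intros p Hp; apply in_sep in Hp as [Hp Hpb]; apply in_sep in Hp as [Hp Hpa], Hpb as [_ Hpb].
  apply in_sep; split; [auto|]; apply (le_meet B leB HB); auto.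
- intros a Ha; assert (Hc := in_compl B leB HB a Ha).
  destruct (hits_cup N j G HN Hj (extent a) (extent (compl a))) as [H|H];
    [|left|right]; try now apply in_induced.
  (* Densely many conditions lie below [a] or below its complement. *)
  apply (hits_dense N j P le G HN Hj HG); split.
  + intros p Hp; apply in_cup in Hp as [Hp|Hp]; now apply in_sep in Hp.
  + intros p Hp; destruct (extent_decides a p Ha Hp) as [H|[r [Hr H]]].
    * exists p; split; [apply in_cup; right; now apply in_sep|auto].
    * exists r; split; [apply in_cup; left; apply in_sep; eauto|auto].
Qed.

Definition decide s : V := sep P (fun p => exists x, app e p ≤ EQ s (chk x)).
(** The local function given by a name. [inhabits p] merely witnesses that the type is nonempty; on
    [decide s] a value exists and, by [value_eq], is unique. *)
Definition value s : V := lam (decide s) (fun p =>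
  epsilon (inhabits p) (fun x => app e p ≤ EQ s (chk x))).

Lemma value_spec s p : p ∈ decide s -> app e p ≤ EQ s (chk (app (value s) p)).
Proof.
intro Hp; unfold value; rewrite app_lam by auto; apply epsilon_spec.
now apply in_sep in Hp.
Qed.

Lemma dom_value s : dom (value s) = decide s.
Proof. apply dom_lam. Qed.

Lemma value_eq s p x : is_name B s -> p ∈ P -> app e p ≤ EQ s (chk x) ->
  p ∈ decide s /\ app (value s) p = x.
Proof.
intros Hs Hp H; assert (Hd : p ∈ decide s) by (apply in_sep; eauto).
split; [auto|].
apply (EQ_decided B leB HB s s _ _ (app e p)); auto using value_spec, EQ_refl.
Qed.

Lemma decide_below s p r x : is_name B s -> p ∈ P -> pair r p ∈ le ->
  app e p ≤ EQ s (chk x) -> app e r ≤ EQ s (chk x).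
Proof.
intros Hs Hp Hr H; apply (ble_trans B leB HB _ (app e p)); eauto using in_EQ, name_check.
Qed.

Lemma local_value s : is_name B s -> local P le (value s).
Proof.
intro Hs; unfold local; rewrite dom_value.
assert (Hlow : forall p, p ∈ decide s -> forall r, pair r p ∈ le ->
  r ∈ decide s /\ app (value s) r = app (value s) p).
{ intros p Hp r Hr; apply value_eq; eauto.
  apply (decide_below s p); auto using value_spec; now apply in_sep in Hp. }
split; [apply lam_fun|split; [split|]].
- intros p Hp; now apply in_sep in Hp.
- intros p Hp r Hr; now apply (Hlow p).
- intros p Hp r Hr; now apply (Hlow p).
Qed.

Let ground_set s : is_name B s -> forall y, (exists x, y = EQ s (chk x)) -> y ∈ B.
Proof. intros Hs y [x ->]; apply in_EQ; auto using name_check. Qed.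

(** The conditions deciding [s], together with those below the complement of [ground s], are dense;
    the filter cannot meet the second kind if it contains [ground s]. *)
Lemma ground_induced s : is_name B s -> (ground s ∈ induced <-> hits (decide s)).
Proof.
intro Hs; assert (Hg : ground s ∈ B) by exact (in_sup B leB HB _ (ground_set s Hs)).
rewrite in_induced; split.
- intros [_ H].
  assert (Hc := in_compl B leB HB _ Hg).
  destruct (hits_cup N j G HN Hj (decide s) (extent (compl (ground s)))) as [H'|H']; [|auto|].
  + apply (hits_dense N j P le G HN Hj HG); split.
    * intros p Hp; apply in_cup in Hp as [Hp|Hp]; now apply in_sep in Hp.
    * intros p Hp; apply NNPP; intro Hn.
      assert (Hm : meet (app e p) (ground s) ∈ B) by (apply in_meet; auto).
      apply Hn; exists p; split; [|auto]; apply in_cup; right; apply in_sep; split; [auto|].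
      apply (le_compl B leB HB); auto.
      apply (sup_elim B leB HB _ _ _ (ground_set s Hs) Hm (in_zero B leB HB)
        (meet_le_r B leB HB _ _ (in_e p Hp) Hg)).
      (* A nonzero [d] would yield an extension of [p] that decides [s], against [Hn]. *)
      intros y d [x ->] Hd Hdm Hdx; apply NNPP; intro Hd0.
      assert (Hx : EQ s (chk x) ∈ B) by (apply ground_set with s; eauto).
      assert (Hdp : d ≤ app e p).
      { apply (ble_trans B leB HB _ _ _ Hd Hm); auto; apply meet_le_l; auto. }
      destruct (dense_below p (EQ s (chk x)) Hp Hx) as [r [Hr Hrx]].
      { intro H0; apply Hd0; apply (ble_trans B leB HB _ (meet (app e p) (EQ s (chk x))));
          auto using in_zero, in_meet; apply (le_meet B leB HB); auto. }
      apply Hn; exists r; split; [|auto]; apply in_cup; left; apply in_sep; eauto.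
  + destruct (hits_nonempty N j G HN Hj _ (hits_inter N j P le G HN Hj HG _ _
      (extent_open _ Hg) (extent_open _ Hc) H H')) as [p Hp].
    apply in_sep in Hp as [Hp Hp2]; apply in_sep in Hp as [Hp Hp1], Hp2 as [_ Hp2].
    destruct (e_pos p Hp).
    rewrite <- (proj1 (proj2 (compl_spec B leB HB _ Hg))); apply (le_meet B leB HB); auto.
- intro H; split; [auto|]; apply (hits_mono N j G HN Hj (decide s)); [|auto].
  intros p Hp; apply in_sep in Hp as [Hp [x Hx]]; apply in_sep; split; [auto|].
  apply (le_sup B leB HB _ _ (EQ s (chk x)) (ground_set s Hs)); eauto.
Qed.

(** Among the conditions deciding both names, those with related values are exactly those below [b].
    So [val_rel] turns the relation between the values into membership of [b] in the ultrafilter. *)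
Lemma decided_rel (R : V -> V -> Prop) s t b y z :
  Def (fun (_ : cls) v => R (v 0) (v 1)) -> is_name B s -> is_name B t -> b ∈ B ->
  (forall x x' p, p ∈ P -> app e p ≤ EQ s (chk x) -> app e p ≤ EQ t (chk x') ->
     (app e p ≤ b <-> R x x')) ->
  val (value s) y -> val (value t) z -> (R y z <-> b ∈ induced).
Proof.
intros HR Hs Ht Hb Hdec Hy Hz; rewrite in_induced.
assert (Ls := local_value s Hs); assert (Lt := local_value t Ht).
rewrite (val_rel N j P le G HN Hj HG R _ _ y z HR Ls Lt Hy Hz), !dom_value.
split; [intro H; split; [auto|]|intros [_ H]].
- apply (hits_mono N j G HN Hj) with (2 := H).
  intros p Hp; apply in_sep in Hp as [Hs' [Ht' Hp]]; assert (Hp' := Hs').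
  apply in_sep in Hp' as [Hp' _]; apply in_sep; split; [auto|].
  apply (Hdec _ _ p Hp' (value_spec s p Hs') (value_spec t p Ht')); auto.
- assert (Hsh := val_hits _ _ _ _ Hy); assert (Hth := val_hits _ _ _ _ Hz).
  rewrite dom_value in Hsh, Hth.
  assert (Os := proj1 (proj2 Ls)); assert (Ot := proj1 (proj2 Lt)).
  rewrite dom_value in Os, Ot.
  destruct Hsh as [p [Gp Hp]], Hth as [q [Gq Hq]], H as [u [Gu Hu]].
  destruct (G_common N j P le G HG p q Gp Gq) as [r [Gr [Pr [Hrp Hrq]]]].
  destruct (G_common N j P le G HG r u Gr Gu) as [w [Gw [Pw [Hwr Hwu]]]].
  assert (Hb' := extent_open b Hb).
  (* [w] extends the conditions [p], [q] and [u], chosen for [s], [t] and [b], so it lies in the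
     images of all three open sets. *)
  assert (Ww : forall X v, open P le X -> v ∈ j X -> pair r v ∈ j le -> w ∈ j X).
  { intros X v HX Hv Hrv; apply (j_open N j P le HN Hj X w r); auto.
    apply (j_open N j P le HN Hj X r v); auto. }
  exists w; split; [auto|].
  refine (transfer N j HN Hj (fun _ v => forall x, x ∈ v 0 -> x ∈ v 1 -> x ∈ v 2 -> x ∈ v 3)
    (scons (decide s) (scons (decide t) (scons (extent b) (fun _ => _)))) _ _ w
    (Ww _ p Os Hp Hrp) (Ww _ q Ot Hq Hrq) _); [def| |exact (j_open N j P le HN Hj _ w u Hb' Hu Pw Hwu)].
  simpl; intros x Hxs Hxt Hxb; apply in_sep in Hxb as [Px Hxb]; apply in_sep; split; [auto|].
  split; [auto|].
  apply (Hdec _ _ x Px (value_spec s x Hxs) (value_spec t x Hxt)); auto.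
Qed.

Context (Hgen : forall y, N y -> exists h, local P le h /\ val h y).

(** Mixing is consistent because [h] is constant along the order: compatible conditions share a
    value with their common extension, and incompatible ones have disjoint images. *)
Lemma mix_value h : local P le h ->
  let s := mix B leB (dom h) (app e) (app h) in
  is_name B s /\ forall p, p ∈ dom h -> p ∈ decide s /\ app (value s) p = app h p.
Proof.
intros [Hf [[HoP Ho] Hh]] s.
assert (Hb : forall i, i ∈ dom h -> app e i ∈ B) by auto.
assert (Hs : is_name B s) by (apply name_mix; auto).
split; [auto|]; intros p Hp; apply value_eq; auto.
apply (EQ_mix B leB HB); auto.
intros i k d Hi Hk Hd Hdi Hdk.
destruct (classic (exists r, r ∈ P /\ pair r i ∈ le /\ pair r k ∈ le)) as [[r [Hr [Hri Hrk]]]|Hn].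
- right; rewrite <- (Hh i Hi r Hri); auto.
- left; pose proof Hcomp as [_ [_ [_ [_ [Hinc _]]]]].
  rewrite <- (Hinc i k (HoP i Hi) (HoP k Hk) Hn); apply (le_meet B leB HB); auto.
Qed.

Theorem induced_ultrapower : exists c, boolean_ultrapower B leB induced c N.
Proof.
(* The collapse evaluates the local function of a name along the filter; on names outside the domain
   its value is arbitrary. *)
exists (fun s => epsilon (inhabits s) (val (value s))).
assert (Hval : forall s, is_name B s /\ ground s ∈ induced ->
  val (value s) (epsilon (inhabits s) (val (value s)))).
{ intros s [Hs Hg]; apply epsilon_spec, val_ex; rewrite dom_value.
  now apply ground_induced. }
split; [apply HN|split; [|split]].
- intro y; split.
  + intro Hy; destruct (Hgen y Hy) as [h [Hh Hhy]].
    destruct (mix_value h Hh) as [Hs Hv]; set (s := mix B leB (dom h) (app e) (app h)) in *.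
    assert (Hg : is_name B s /\ ground s ∈ induced).
    { split; [auto|]; apply ground_induced; [auto|].
      apply (hits_mono N j G HN Hj (dom h)); [|exact (val_hits _ _ _ _ Hhy)].
      intros p Hp; now apply Hv. }
    exists s; split; [auto|].
    (* The mixed name has the value [y] because its local function agrees with [h] on [dom h], which
       the filter meets. *)
    apply (val_rel N j P le G HN Hj HG eq (value s) h); auto using local_value; [def|].
    apply (hits_mono N j G HN Hj (dom h)); [|exact (val_hits _ _ _ _ Hhy)].
    intros p Hp; apply in_sep; rewrite dom_value; split; [now apply Hv|].
    split; [auto|now apply Hv].
  + intros [s [Hs <-]]; apply (val_in N j P le G HN Hj HG (value s)); auto.
- intros s t Hs Ht; apply (decided_rel eq s t); auto; try apply Hs; try apply Ht; [def|..].
  + apply in_EQ; [auto|apply Hs|apply Ht].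
  + intros x x' p Hp; apply (EQ_decided B leB HB); [apply Hs|apply Ht|auto|auto].
- intros s t Hs Ht; apply (decided_rel mem s t); auto; try apply Hs; try apply Ht; [def|..].
  + apply in_MEM; [auto|apply Hs|apply Ht].
  + intros x x' p Hp; apply (MEM_decided B leB HB); [apply Hs|apply Ht|auto|auto].
Qed.

End Induced.

(** * Assembly: elements of the last model as values of local functions *)

Theorem theorem2p6 (V : zfc) (kappa alpha : V) (U : V -> V) (f : V -> V -> V)
    (M : V -> V -> Prop) (pi : V -> V -> V -> V) (kap : V -> V) (B leB e : V)
    (Hkappa : cardinal kappa)
    (Halpha : alpha ∈ kappa)
    (HU : forall gamma, gamma ∈ alpha -> normal_ultrafilter kappa (U gamma))
    (Hmitchell : forall gamma delta, delta ∈ alpha -> gamma ∈ delta ->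
       mitchell kappa (U gamma) (U delta))
    (Hf : forall gamma delta, delta ∈ alpha -> gamma ∈ delta ->
       is_fun (f delta gamma) kappa /\
       ult_class kappa (U delta) (f delta gamma) (U gamma))
    (HB : completion (magidor kappa alpha U f) (magidor_order kappa alpha U f)
            B leB e)
    (Hiter : iteration kappa alpha U M pi)
    (Hcrit : forall gamma, gamma ∈ alpha ->
       critical_point (M gamma) (pi gamma (succ gamma)) (kap gamma))
    (Hgeneric : generic (M alpha)
       (pi empty alpha (magidor kappa alpha U f))
       (pi empty alpha (magidor_order kappa alpha U f))
       (G_crit alpha (pi empty alpha (magidor kappa alpha U f)) kap)) :
  let j := pi empty alpha in
  let G := G_crit alpha (j (magidor kappa alpha U f)) kap in
  let Gstar := generated (j B) (j leB) (j e) G in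
  let F := sep B (fun b => Gstar (j b)) in
  boolean_ultrafilter B leB F /\
  exists c : V -> V, boolean_ultrapower B leB F c (M alpha).
Proof.
intros j G Gstar F.
set (P := magidor kappa alpha U f) in *; set (le := magidor_order kappa alpha U f) in *.
destruct Hkappa as [Hk _].
assert (Ha := self_le alpha).
assert (HN : good (M alpha)) by (eapply M_good; eauto).
assert (Hj : elem top (M alpha) j) by (eapply j_elem; eauto).
assert (P_refl : forall p, p ∈ P -> pair p p ∈ le) by (intros; now apply magidor_refl).
assert (P_in : forall r p, pair r p ∈ le -> r ∈ P)
  by (intros r p H; now apply in_magidor_order in H).
assert (P_sub : forall r p, pair r p ∈ le -> pfst p ⊆ pfst r)
  by (intros r p H; now apply in_magidor_order in H).
assert (P_fun : forall p, p ∈ P -> is_fun (pfst p) (dom (pfst p)))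
  by (intros p Hp; now apply magidor_fun in Hp).
assert (Hgen : forall y, M alpha y -> exists h, local P le h /\ val j G h y).
{ apply (stage_ind kappa alpha U M pi Hk Halpha HU Hiter kap Hcrit).
  - intro x; exists (lam P (fun _ => x)); now apply (local_const (M alpha)).
  - intros xi y Hxi [h [Hh Hy]].
    (* [xi] lies in [alpha], hence in [kappa], below which the whole iteration fixes everything. *)
    assert (Ejxi : j xi = xi).
    { apply (pi_fix kappa alpha U M pi Hk Halpha HU Hiter alpha empty xi Ha).
      - apply empty_le, (ord_mem kappa); auto.
      - rewrite (proj1 (proj2 Hiter)); [|apply empty_le, (ord_mem kappa); auto|].
        + apply (ord_trans kappa alpha); auto.
        + apply (proj1 Hiter). }
    assert (HGc : forall p, G p ->
      (xi ∈ dom (pfst p) -> app (pfst p) xi = kap xi) /\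
      (xi ∈ dom (pfst p) \/ kap xi ∈ app (psnd p) xi)).
    { intros p [_ [s [T [-> [H1 H2]]]]]; rewrite pfst_pair, psnd_pair; split; [auto|].
      destruct (classic (xi ∈ dom s)); [auto|right; apply H2, in_diff; auto]. }
    destruct (coord_hits (M alpha) j P le G HN Hj Hgeneric xi (kap xi)) as [p [Gp Hp]].
    + intros p x Hp; apply magidor_shrink; auto.
    + apply (kap_fix kappa alpha U M pi Hk Halpha HU Hiter kap Hcrit xi Hxi).
    + intros p Gp; rewrite Ejxi; now apply HGc.
    + assert (Hy' := Hy); destruct Hy' as [q [Gq [Hq _]]].
      (* [r] is in the domain of [j h] and has [xi] in its stem, where membership in [G] makes the
         entry [kap xi]; so [coord h xi] has the required value. *)
      destruct (G_common (M alpha) j P le G Hgeneric p q Gp Gq) as [r [Gr [Pr [Hrp Hrq]]]].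
      assert (Hr : r ∈ j (dom h)).
      { exact (proj1 (val_below (M alpha) j P le HN Hj h q r Hh Hq Pr Hrq)). }
      assert (Hsub : pfst p ⊆ pfst r).
      { refine (transfer (M alpha) j HN Hj (fun _ v => forall p, p ∈ v 0 -> forall r, r ∈ v 0 ->
          pair r p ∈ v 1 -> forall x, x ∈ pfst p -> x ∈ pfst r) (scons P (fun _ => le)) _ _
          p (G_P _ _ _ _ _ Hgeneric p Gp) r Pr Hrp).
        - do 2 (apply Def_ball; [def|]); apply Def_imp; [def|].
          apply Def_ball; [apply DefT_pfst; def|]; apply Def_mem; [def|apply DefT_pfst; def].
        - simpl; intros p' _ r' _ H; now apply P_sub. }
      assert (Hxr : j xi ∈ dom (pfst r)).
      { apply in_dom in Hp as [z Hz]; apply in_dom; eauto. }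
      exists (coord h xi); split; [now apply local_coord|].
      assert (Hv := val_coord (M alpha) j P le G HN Hj Hgeneric h xi y r Hh Hy Gr Hr Hxr).
      rewrite Ejxi in *; now rewrite (proj1 (HGc r Gr)) in Hv. }
split.
- exact (induced_ultrafilter (M alpha) j P le G B leB e HN Hj Hgeneric P_refl P_in HB).
- exact (induced_ultrapower (M alpha) j P le G B leB e HN Hj Hgeneric P_refl P_in HB Hgen).
Qed.
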